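(* Let $y(t)=(y_1(t),\dots,y_N(t))$, $t\in\mathbb{R}$, be a $C^\infty$-smooth $\mathbb{C}^N$-valued function near $t=0$ with $y(0)=0$ satisfying $$t\,\frac{dy_j}{dt}=f_j(t,y(t)),\qquad j=1,\dots,N,$$ where the $f_j(t,y)$ are holomorphic functions in a neighborhood of $(0,0)\in\mathbb{C}\times\mathbb{C}^N$. Then $y(t)$ is real-analytic near $t=0$. *)

(* Defs.v *)
From Stdlib Require Import Reals.
From Coquelicot Require Import Coquelicot.
From mathcomp Require Import ssreflect ssrfun ssrbool eqtype ssrnat seq fintype bigop.
Open Scope R_scope.

Definition csum (N : nat) (v : 'I_N -> C) : C := \big[Cplus/RtoC 0]_(k < N) v k.
Definition rsum (N : nat) (v : 'I_N -> R) : R := \big[Rplus/0]_(k < N) v k.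
Arguments csum {N} v.
Arguments rsum {N} v.

Definition C_differentiable_at (N : nat) (F : C -> ('I_N -> C) -> C)
  (z : C) (w : 'I_N -> C) : Prop :=
  exists (a0 : C) (a : 'I_N -> C),
    forall eps : R, 0 < eps -> exists delta : R, 0 < delta /\
      forall (h0 : C) (h : 'I_N -> C),
        Cmod h0 < delta -> (forall k, Cmod (h k) < delta) ->
        Cmod (Cminus (Cminus (F (Cplus z h0) (fun k => Cplus (w k) (h k))) (F z w))
                     (Cplus (Cmult a0 h0) (csum (fun k => Cmult (a k) (h k)))))
          <= eps * (Cmod h0 + rsum (fun k => Cmod (h k))).

Definition holomorphic_near_0 (N : nat) (F : C -> ('I_N -> C) -> C) : Prop :=
  exists rho : R, 0 < rho /\
    forall (z : C) (w : 'I_N -> C),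
      Cmod z < rho -> (forall k, Cmod (w k) < rho) -> @C_differentiable_at N F z w.

Definition smooth_on (r : R) (g : R -> C) : Prop :=
  forall (n : nat) (t : R), Rabs t < r ->
    ex_derive_n (fun s => Re (g s)) n t /\ ex_derive_n (fun s => Im (g s)) n t.

Definition cderive (g : R -> C) (t : R) : C :=
  (Derive (fun s => Re (g s)) t, Derive (fun s => Im (g s)) t).

Definition real_analytic_at (g : R -> C) (t0 : R) : Prop :=
  exists (rho : R) (a : nat -> C), 0 < rho /\
    forall t : R, Rabs (t - t0) < rho ->
      is_series (fun n => Cmult (a n) (RtoC ((t - t0) ^ n))) (g t).

Definition real_analytic_near_0 (g : R -> C) : Prop :=
  exists r : R, 0 < r /\ forall t0 : R, Rabs t0 < r -> real_analytic_at g t0.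
Arguments C_differentiable_at {N} F z w.
Arguments holomorphic_near_0 {N} F.

(* Main.v *)
(* A solution [y] that is smooth at the singular point [t = 0] agrees to every order [m] with a
   polynomial [P]. Starting from [u_0 = P], solve [z u_{k+1}' = f (z, u_k)] by power series on a
   complex disc: dividing the [n]-th coefficient by [n] makes the iteration contract by the factor
   [L / m] in the norm [sup |v z| / |z|^m], where [L] is a Lipschitz constant of [f]. For
   [m >= 2 L] the iterates converge uniformly on the disc, and, by the same estimate on the real
   interval, their limit there is [y]. Complex differentiability enters only through one-variable
   theory: Goursat's bisection, in coordinates adapted to the circle, gives Cauchy's formula and
   hence power series with the Cauchy estimates. *)

Require Import Defs.
From Stdlib Require Import Reals Lra Lia Psatz ClassicalEpsilon FunctionalExtensionality Arith.
From Coquelicot Require Import Coquelicot.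
Open Scope R_scope.

(** * Complex derivatives and integrals of complex-valued functions *)

(** The equation alone does not determine [y]: [t y' = k y], with [k] a positive integer, is solved
    by every multiple of [t^k], and a formal power series may meet a resonance at an eigenvalue of
    the linear part. A starting polynomial that agrees with [y] to order [m] takes all low orders
    from the given solution; above them, division by [n >= m] beats the Lipschitz constant. The
    obstacle is that this agreement is known only on the real line, while the contraction runs on a
    complex disc. The bridge is [y1 - P], with [y1] the first iterate: for small real [t > 0] both
    terms are within [O(t^m)] of [y], so this holomorphic function has no coefficient below [m] and
    is [O(|z|^m)] on a disc. The constant [L = 16 M / rho] is Cauchy's estimate on the complex line
    through two arguments of [f]. No function space is built: the iterates are compared by explicit
    bounds, and the limit is assembled from their Taylor coefficients, which converge
    geometrically. *)

Definition has_deriv (h : C -> C) (z c : C) : Prop :=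
  forall eps : R, 0 < eps -> exists delta : R, 0 < delta /\
    forall w : C, Cmod w < delta ->
      Cmod (h (z + w) - h z - c * w)%C <= eps * Cmod w.

(** Componentwise, like the integral [CInt], so that the real theory of continuity and of the
    Riemann integral applies to each part; the form in terms of [Cmod] is recovered in
    [Ccontinuous_eps]. *)
Definition Ccontinuous (F : R -> C) (x : R) : Prop :=
  continuous (fun t => Re (F t)) x /\ continuous (fun t => Im (F t)) x.

Lemma Cmod_minus_sym (a b : C) : Cmod (a - b)%C = Cmod (b - a)%C.
Proof. rewrite <- Cmod_opp. f_equal. ring. Qed.

Lemma Cmod_le_Re_Im (z : C) : Cmod z <= Rabs (Re z) + Rabs (Im z).
Proof.
  replace z with (RtoC (Re z) + Ci * RtoC (Im z))%C at 1.
  - eapply Rle_trans; [apply Cmod_triangle|].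
    rewrite Cmod_mult, Cmod_Ci, !Cmod_R. lra.
  - destruct z as [u v]; apply injective_projections; unfold Re, Im; simpl; ring.
Qed.

Lemma im_le_Cmod (z : C) : Rabs (Im z) <= Cmod z.
Proof. eapply Rle_trans; [apply Rmax_r|apply Rmax_Cmod]. Qed.

Lemma continuous_eps (f : R -> R) (x : R) :
  continuous f x <-> forall eps, 0 < eps -> exists delta, 0 < delta /\
    forall u, Rabs (u - x) < delta -> Rabs (f u - f x) < eps.
Proof.
  split.
  - intros H eps He.
    apply filterlim_locally with (eps := mkposreal eps He) in H.
    destruct H as [d Hd]. exists d. split; [apply cond_pos|].
    intros u Hu. exact (Hd u Hu).
  - intros H. apply filterlim_locally. intros eps.
    destruct (H eps (cond_pos eps)) as [d [Hd0 Hd]].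
    exists (mkposreal d Hd0). intros u Hu. exact (Hd u Hu).
Qed.

Lemma Ccontinuous_eps (F : R -> C) (x : R) :
  Ccontinuous F x <-> forall eps, 0 < eps -> exists delta, 0 < delta /\
    forall u, Rabs (u - x) < delta -> Cmod (F u - F x)%C < eps.
Proof.
  split.
  - intros [H1 H2] eps He.
    destruct (proj1 (continuous_eps _ _) H1 (eps / 2)) as [d1 [Hd1 K1]]; [lra|].
    destruct (proj1 (continuous_eps _ _) H2 (eps / 2)) as [d2 [Hd2 K2]]; [lra|].
    exists (Rmin d1 d2). split; [now apply Rmin_pos|]. intros u Hu.
    specialize (K1 u (Rlt_le_trans _ _ _ Hu (Rmin_l _ _))).
    specialize (K2 u (Rlt_le_trans _ _ _ Hu (Rmin_r _ _))).
    eapply Rle_lt_trans; [apply Cmod_le_Re_Im|].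
    change (Rabs (Re (F u) - Re (F x)) + Rabs (Im (F u) - Im (F x)) < eps). lra.
  - intros H. split; apply continuous_eps; intros eps He;
      destruct (H eps He) as [d [Hd K]]; exists d; split; trivial; intros u Hu;
      (eapply Rle_lt_trans; [|exact (K u Hu)]).
    + apply (re_le_Cmod (F u - F x)%C).
    + apply (im_le_Cmod (F u - F x)%C).
Qed.

Lemma Ccontinuous_const (c : C) (x : R) : Ccontinuous (fun _ => c) x.
Proof. split; apply continuous_const. Qed.

Lemma Ccontinuous_plus (F G : R -> C) (x : R) :
  Ccontinuous F x -> Ccontinuous G x -> Ccontinuous (fun t => F t + G t)%C x.
Proof.
  intros [H1 H2] [H3 H4]. split; simpl.
  - apply (continuous_plus (fun t => Re (F t)) (fun t => Re (G t))); trivial.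
  - apply (continuous_plus (fun t => Im (F t)) (fun t => Im (G t))); trivial.
Qed.

Lemma Ccontinuous_mult (F G : R -> C) (x : R) :
  Ccontinuous F x -> Ccontinuous G x -> Ccontinuous (fun t => F t * G t)%C x.
Proof.
  intros [H1 H2] [H3 H4]. split; simpl.
  - apply (continuous_minus (fun t => Re (F t) * Re (G t)) (fun t => Im (F t) * Im (G t)));
      now apply (continuous_mult (K := R_AbsRing)).
  - apply (continuous_plus (fun t => Re (F t) * Im (G t)) (fun t => Im (F t) * Re (G t)));
      now apply (continuous_mult (K := R_AbsRing)).
Qed.

Lemma Ccontinuous_minus (F G : R -> C) (x : R) :
  Ccontinuous F x -> Ccontinuous G x -> Ccontinuous (fun t => F t - G t)%C x.
Proof.
  intros [H1 H2] [H3 H4]. split; simpl.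
  - apply (continuous_minus (fun t => Re (F t)) (fun t => Re (G t))); trivial.
  - apply (continuous_minus (fun t => Im (F t)) (fun t => Im (G t))); trivial.
Qed.

Lemma Ccontinuous_RtoC (f : R -> R) (x : R) :
  continuous f x -> Ccontinuous (fun t => RtoC (f t)) x.
Proof. intros H. split; simpl; [exact H | apply continuous_const]. Qed.

Lemma Ccontinuous_pow (F : R -> C) (n : nat) (x : R) :
  Ccontinuous F x -> Ccontinuous (fun t => F t ^ n)%C x.
Proof.
  intros H. induction n as [|n IH]; simpl.
  - apply Ccontinuous_const.
  - now apply Ccontinuous_mult.
Qed.

Lemma has_deriv_continuous (h : C -> C) (z c : C) : has_deriv h z c ->
  forall eps, 0 < eps -> exists delta, 0 < delta /\
    forall w, Cmod (w - z)%C < delta -> Cmod (h w - h z)%C < eps.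
Proof.
  intros H eps He. destruct (H 1 Rlt_0_1) as [d [Hd K]].
  pose proof (Cmod_ge_0 c) as Hc.
  exists (Rmin d (eps / (Cmod c + 2))). split.
  { apply Rmin_pos; trivial. apply Rdiv_lt_0_compat; lra. }
  intros w Hw.
  specialize (K (w - z)%C (Rlt_le_trans _ _ _ Hw (Rmin_l _ _))).
  replace (z + (w - z))%C with w in K by ring.
  pose proof (Rlt_le_trans _ _ _ Hw (Rmin_r _ _)) as Hw2.
  apply (Rmult_lt_compat_r (Cmod c + 2)) in Hw2; [|lra].
  replace (eps / (Cmod c + 2) * (Cmod c + 2)) with eps in Hw2 by (field; lra).
  replace (h w - h z)%C with ((h w - h z - c * (w - z)) + c * (w - z))%C by ring.
  eapply Rle_lt_trans; [apply Cmod_triangle|]. rewrite Cmod_mult.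
  pose proof (Cmod_ge_0 (w - z)%C). nra.
Qed.

Lemma Ccontinuous_comp (h : C -> C) (F : R -> C) (x : R) (c : C) :
  has_deriv h (F x) c -> Ccontinuous F x -> Ccontinuous (fun t => h (F t)) x.
Proof.
  intros Hh HF. apply Ccontinuous_eps. intros eps He.
  destruct (has_deriv_continuous _ _ _ Hh eps He) as [d [Hd K]].
  destruct (proj1 (Ccontinuous_eps _ _) HF d Hd) as [e [He' K']].
  exists e. split; trivial. intros u Hu. apply K, K', Hu.
Qed.

Definition CInt (F : R -> C) (a b : R) : C :=
  (RInt (fun t => Re (F t)) a b, RInt (fun t => Im (F t)) a b).

Definition Ccontinuous_on (F : R -> C) (a b : R) : Prop :=
  forall x, a <= x <= b -> Ccontinuous F x.

Lemma Ccontinuous_on_ex_RInt (F : R -> C) (a b : R) : a <= b -> Ccontinuous_on F a b ->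
  ex_RInt (fun t => Re (F t)) a b /\ ex_RInt (fun t => Im (F t)) a b.
Proof.
  intros Hab H. split; apply (ex_RInt_continuous (V := R_CompleteNormedModule));
    intros x; rewrite Rmin_left, Rmax_right by trivial; intros Hx; apply (H x Hx).
Qed.

Lemma CInt_ext (F G : R -> C) (a b : R) : a <= b ->
  (forall x, a <= x <= b -> F x = G x) -> CInt F a b = CInt G a b.
Proof.
  intros Hab H. unfold CInt.
  f_equal; apply RInt_ext; rewrite Rmin_left, Rmax_right by trivial; intros x Hx;
    rewrite H by lra; reflexivity.
Qed.

Lemma CInt_plus (F G : R -> C) (a b : R) : a <= b ->
  Ccontinuous_on F a b -> Ccontinuous_on G a b ->
  CInt (fun t => F t + G t)%C a b = (CInt F a b + CInt G a b)%C.
Proof.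
  intros Hab HF HG.
  destruct (Ccontinuous_on_ex_RInt _ _ _ Hab HF) as [F1 F2].
  destruct (Ccontinuous_on_ex_RInt _ _ _ Hab HG) as [G1 G2].
  apply injective_projections; simpl.
  - apply (RInt_plus (V := R_CompleteNormedModule) _ _ _ _ F1 G1).
  - apply (RInt_plus (V := R_CompleteNormedModule) _ _ _ _ F2 G2).
Qed.

Lemma CInt_scal (c : C) (F : R -> C) (a b : R) : a <= b ->
  Ccontinuous_on F a b -> CInt (fun t => c * F t)%C a b = (c * CInt F a b)%C.
Proof.
  intros Hab HF.
  destruct (Ccontinuous_on_ex_RInt _ _ _ Hab HF) as [F1 F2].
  assert (S : forall (k : R) (f : R -> R), ex_RInt f a b -> ex_RInt (fun t => k * f t) a b).
  { intros k f Hf. apply (ex_RInt_scal (V := R_CompleteNormedModule) f a b k Hf). }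
  assert (S' : forall (k : R) (f : R -> R), ex_RInt f a b ->
     RInt (fun t => k * f t) a b = k * RInt f a b).
  { intros k f Hf. apply (RInt_scal (V := R_CompleteNormedModule) f a b k Hf). }
  apply injective_projections; simpl.
  - rewrite <- (S' _ _ F1), <- (S' _ _ F2).
    apply (RInt_minus (V := R_CompleteNormedModule)); now apply S.
  - rewrite <- (S' _ _ F1), <- (S' _ _ F2).
    apply (RInt_plus (V := R_CompleteNormedModule)); now apply S.
Qed.

Lemma CInt_Chasles (F : R -> C) (a b c : R) : a <= b -> b <= c ->
  Ccontinuous_on F a c -> CInt F a c = (CInt F a b + CInt F b c)%C.
Proof.
  intros Hab Hbc HF.
  assert (H1 : Ccontinuous_on F a b) by (intros x Hx; apply HF; lra).
  assert (H2 : Ccontinuous_on F b c) by (intros x Hx; apply HF; lra).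
  destruct (Ccontinuous_on_ex_RInt _ _ _ Hab H1) as [F1 F2].
  destruct (Ccontinuous_on_ex_RInt _ _ _ Hbc H2) as [G1 G2].
  apply injective_projections; simpl; symmetry;
    apply (RInt_Chasles (V := R_CompleteNormedModule)); trivial.
Qed.

(** The factor 2 comes from bounding the real and imaginary parts separately. It survives as the 2
    in the Cauchy estimates [2 * M / r ^ n]. *)
Lemma CInt_bound (F : R -> C) (a b M : R) : a <= b -> Ccontinuous_on F a b ->
  (forall x, a <= x <= b -> Cmod (F x) <= M) -> Cmod (CInt F a b) <= 2 * M * (b - a).
Proof.
  intros Hab HF HM.
  destruct (Ccontinuous_on_ex_RInt _ _ _ Hab HF) as [F1 F2].
  eapply Rle_trans; [apply Cmod_le_Re_Im|]. simpl.
  assert (Rabs (RInt (fun t => Re (F t)) a b) <= (b - a) * M).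
  { apply abs_RInt_le_const; trivial. intros t Ht.
    eapply Rle_trans; [apply re_le_Cmod|auto]. }
  assert (Rabs (RInt (fun t => Im (F t)) a b) <= (b - a) * M).
  { apply abs_RInt_le_const; trivial. intros t Ht.
    eapply Rle_trans; [apply im_le_Cmod|auto]. }
  lra.
Qed.

Lemma CInt_const (c : C) (a b : R) : CInt (fun _ => c) a b = (RtoC (b - a) * c)%C.
Proof.
  unfold CInt. rewrite !RInt_const.
  apply injective_projections; simpl; unfold scal; simpl; unfold mult, Re, Im; simpl; ring.
Qed.

Lemma CInt_derive (F G : R -> C) (a b : R) : a <= b -> Ccontinuous_on G a b ->
  (forall x, is_derive (fun t => Re (F t)) x (Re (G x))) ->
  (forall x, is_derive (fun t => Im (F t)) x (Im (G x))) ->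
  CInt G a b = (F b - F a)%C.
Proof.
  intros Hab HG H1 H2.
  apply injective_projections; simpl;
    apply (is_RInt_unique (V := R_CompleteNormedModule));
    [apply (is_RInt_derive (V := R_CompleteNormedModule) (fun t => Re (F t)))
    |apply (is_RInt_derive (V := R_CompleteNormedModule) (fun t => Im (F t)))];
    trivial; intros x; rewrite Rmin_left, Rmax_right by trivial; intros Hx; apply (HG x Hx).
Qed.

(** * Goursat's bisection *)

(** Serves twice: for the nested rectangles of the bisection and for the sequence of iterates. The
    invariant [P] travels in a sigma type because a successor exists only where [P] holds. *)
Lemma dependent_choice (A : Type) (P : A -> Prop) (Rel : A -> A -> Prop) (x0 : A) :
  P x0 -> (forall x, P x -> exists y, P y /\ Rel x y) ->
  exists u : nat -> A, u O = x0 /\ forall n, P (u n) /\ Rel (u n) (u (S n)).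
Proof.
  intros H0 Hs.
  assert (Hs' : forall x : {x | P x}, exists y : {x | P x}, Rel (proj1_sig x) (proj1_sig y)).
  { intros [x Hx]. destruct (Hs x Hx) as [y [Py Ry]]. now exists (exist _ y Py). }
  pose (next := fun x => proj1_sig (constructive_indefinite_description _ (Hs' x))).
  pose (u := fix u n := match n with O => exist P x0 H0 | S k => next (u k) end).
  exists (fun n => proj1_sig (u n)). split; trivial. intros n. split.
  - exact (proj2_sig (u n)).
  - exact (proj2_sig (constructive_indefinite_description _ (Hs' (u n)))).
Qed.

Lemma nested_intervals (x1 x2 : nat -> R) :
  (forall n, x1 n <= x1 (S n)) -> (forall n, x2 (S n) <= x2 n) ->
  (forall n, x1 n <= x2 n) -> exists l, forall n, x1 n <= l <= x2 n.
Proof.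
  intros H1 H2 H12.
  assert (M1 : forall n k, x1 n <= x1 (n + k)%nat).
  { intros n k. induction k as [|k IH]; [rewrite Nat.add_0_r; lra|].
    rewrite Nat.add_succ_r. specialize (H1 (n + k)%nat). lra. }
  assert (M2 : forall n k, x2 (n + k)%nat <= x2 n).
  { intros n k. induction k as [|k IH]; [rewrite Nat.add_0_r; lra|].
    rewrite Nat.add_succ_r. specialize (H2 (n + k)%nat). lra. }
  assert (M : forall n k, x1 n <= x2 k).
  { intros n k. specialize (M1 n k). specialize (M2 k n). rewrite Nat.add_comm in M2.
    specialize (H12 (n + k)%nat). lra. }
  destruct (completeness (fun x => exists n, x = x1 n)) as [l [L1 L2]].
  - exists (x2 O). intros x [n ->]. apply M.
  - now exists (x1 O), O.
  - exists l. intros n. split; [apply L1; now exists n|].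
    apply L2. intros x [k ->]. apply M.
Qed.

Lemma half_pow_small (A eps : R) : 0 < eps -> exists n, A * (/ 2) ^ n < eps.
Proof.
  intros He.
  destruct (pow_lt_1_zero (/ 2)) with (y := eps / (Rabs A + 1)) as [n Hn].
  - rewrite Rabs_pos_eq; lra.
  - pose proof (Rabs_pos A). apply Rdiv_lt_0_compat; lra.
  - exists n. specialize (Hn n (le_n _)).
    assert (Hp : 0 < (/ 2) ^ n) by (apply pow_lt; lra).
    rewrite Rabs_pos_eq in Hn by lra.
    pose proof (Rle_abs A). pose proof (Rabs_pos A).
    apply (Rmult_lt_compat_r (Rabs A + 1)) in Hn; [|lra].
    replace (eps / (Rabs A + 1) * (Rabs A + 1)) with eps in Hn by (field; lra).
    nra.
Qed.

(* Goursat's bisection: among the four quarters of a rectangle on which [I] exceeds [eps]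
   times the squared semiperimeter, one has the same property. *)
Lemma additive_rectangle_function_zero (I : R -> R -> R -> R -> C) (a b c d : R) :
  a <= b -> c <= d ->
  (forall x1 m x2 y1 y2, a <= x1 <= m -> m <= x2 <= b -> c <= y1 <= y2 -> y2 <= d ->
     I x1 x2 y1 y2 = I x1 m y1 y2 + I m x2 y1 y2)%C ->
  (forall x1 x2 y1 m y2, a <= x1 <= x2 -> x2 <= b -> c <= y1 <= m -> m <= y2 <= d ->
     I x1 x2 y1 y2 = I x1 x2 y1 m + I x1 x2 m y2)%C ->
  (forall u v, a <= u <= b -> c <= v <= d -> forall eps, 0 < eps ->
     exists delta, 0 < delta /\ forall x1 x2 y1 y2,
       a <= x1 <= u -> u <= x2 <= b -> c <= y1 <= v -> v <= y2 <= d ->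
       x2 - x1 < delta -> y2 - y1 < delta ->
       Cmod (I x1 x2 y1 y2) <= eps * ((x2 - x1) + (y2 - y1)) ^ 2) ->
  I a b c d = RtoC 0.
Proof.
  intros Hab Hcd addx addy loc. apply Cmod_eq_0.
  destruct (Rle_lt_or_eq_dec _ _ (Cmod_ge_0 (I a b c d))) as [Hpos|]; [exfalso|easy].
  set (s0 := (b - a) + (d - c)).
  (* The [+ 1] keeps the quotient meaningful for a degenerate rectangle and makes the starting
     inequality strict. *)
  set (eps := Cmod (I a b c d) / (s0 ^ 2 + 1)).
  assert (Hs0 : 0 <= s0 ^ 2) by (apply pow2_ge_0).
  assert (He : 0 < eps) by (apply Rdiv_lt_0_compat; lra).
  assert (Hbad : eps * s0 ^ 2 < Cmod (I a b c d)).
  { replace (Cmod (I a b c d)) with (eps * (s0 ^ 2 + 1)) by (unfold eps; field; lra). lra. }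
  pose (P := fun q : (R * R) * (R * R) =>
    let '((x1, x2), (y1, y2)) := q in
    (a <= x1 /\ x1 <= x2 /\ x2 <= b) /\ (c <= y1 /\ y1 <= y2 /\ y2 <= d) /\
    eps * ((x2 - x1) + (y2 - y1)) ^ 2 < Cmod (I x1 x2 y1 y2)).
  pose (Rel := fun q q' : (R * R) * (R * R) =>
    let '((x1, x2), (y1, y2)) := q in
    let '((x1', x2'), (y1', y2')) := q' in
    x1 <= x1' /\ x2' <= x2 /\ y1 <= y1' /\ y2' <= y2 /\
    x2' - x1' = (x2 - x1) / 2 /\ y2' - y1' = (y2 - y1) / 2).
  destruct (dependent_choice _ P Rel ((a, b), (c, d))) as [q [q0 Hq]].
  - simpl. fold s0. lra.
  - intros [[x1 x2] [y1 y2]] [Hx [Hy Hb]]. unfold P, Rel.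
    set (xm := (x1 + x2) / 2). set (ym := (y1 + y2) / 2).
    set (s := (x2 - x1) + (y2 - y1)) in *.
    assert (E : I x1 x2 y1 y2 =
      ((I x1 xm y1 ym + I x1 xm ym y2) + (I xm x2 y1 ym + I xm x2 ym y2))%C).
    { rewrite (addx x1 xm x2 y1 y2), (addy x1 xm y1 ym y2), (addy xm x2 y1 ym y2);
        unfold xm, ym; trivial; lra. }
    assert (T : Cmod (I x1 x2 y1 y2) <= (Cmod (I x1 xm y1 ym) + Cmod (I x1 xm ym y2))
       + (Cmod (I xm x2 y1 ym) + Cmod (I xm x2 ym y2))).
    { rewrite E. eapply Rle_trans; [apply Cmod_triangle|].
      apply Rplus_le_compat; apply Cmod_triangle. }
    (* Halving both sides divides the squared semiperimeter by 4, so four quarters within the bound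
       would put the whole rectangle within it. *)
    assert (Q : forall u1 u2 v1 v2, u2 - u1 = (x2 - x1) / 2 -> v2 - v1 = (y2 - y1) / 2 ->
      eps * ((u2 - u1) + (v2 - v1)) ^ 2 = eps * s ^ 2 / 4).
    { intros u1 u2 v1 v2 -> ->. unfold s. field. }
    destruct (Rle_lt_dec (Cmod (I x1 xm y1 ym)) (eps * s ^ 2 / 4)) as [L1|L1];
    [destruct (Rle_lt_dec (Cmod (I x1 xm ym y2)) (eps * s ^ 2 / 4)) as [L2|L2];
    [destruct (Rle_lt_dec (Cmod (I xm x2 y1 ym)) (eps * s ^ 2 / 4)) as [L3|L3];
    [destruct (Rle_lt_dec (Cmod (I xm x2 ym y2)) (eps * s ^ 2 / 4)) as [L4|L4];
    [exfalso; lra|]|]|]|].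
    + exists ((xm, x2), (ym, y2)). rewrite Q by (unfold xm, ym; field).
      unfold xm, ym in *. lra.
    + exists ((xm, x2), (y1, ym)). rewrite Q by (unfold xm, ym; field).
      unfold xm, ym in *. lra.
    + exists ((x1, xm), (ym, y2)). rewrite Q by (unfold xm, ym; field).
      unfold xm, ym in *. lra.
    + exists ((x1, xm), (y1, ym)). rewrite Q by (unfold xm, ym; field).
      unfold xm, ym in *. lra.
  - pose (x1 := fun n => fst (fst (q n))). pose (x2 := fun n => snd (fst (q n))).
    pose (y1 := fun n => fst (snd (q n))). pose (y2 := fun n => snd (snd (q n))).
    assert (HP : forall n, (a <= x1 n /\ x1 n <= x2 n /\ x2 n <= b) /\
      (c <= y1 n /\ y1 n <= y2 n /\ y2 n <= d) /\
      eps * ((x2 n - x1 n) + (y2 n - y1 n)) ^ 2 < Cmod (I (x1 n) (x2 n) (y1 n) (y2 n))).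
    { intros n. destruct (Hq n) as [Hn _]. unfold x1, x2, y1, y2, P in *.
      destruct (q n) as [[? ?] [? ?]]. exact Hn. }
    assert (HR : forall n, x1 n <= x1 (S n) /\ x2 (S n) <= x2 n /\
      y1 n <= y1 (S n) /\ y2 (S n) <= y2 n /\
      x2 (S n) - x1 (S n) = (x2 n - x1 n) / 2 /\ y2 (S n) - y1 (S n) = (y2 n - y1 n) / 2).
    { intros n. destruct (Hq n) as [_ Hn]. unfold x1, x2, y1, y2, Rel in *.
      destruct (q n) as [[? ?] [? ?]], (q (S n)) as [[? ?] [? ?]]. exact Hn. }
    destruct (nested_intervals x1 x2) as [u Hu]; try (intros n; apply HR || apply HP).
    destruct (nested_intervals y1 y2) as [v Hv]; try (intros n; apply HR || apply HP).
    assert (Wx : forall n, x2 n - x1 n = (b - a) * (/ 2) ^ n).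
    { intros n. induction n as [|n IH].
      - unfold x1, x2. rewrite q0. simpl. ring.
      - destruct (HR n) as (_ & _ & _ & _ & -> & _). rewrite IH. simpl. field. }
    assert (Wy : forall n, y2 n - y1 n = (d - c) * (/ 2) ^ n).
    { intros n. induction n as [|n IH].
      - unfold y1, y2. rewrite q0. simpl. ring.
      - destruct (HR n) as (_ & _ & _ & _ & _ & ->). rewrite IH. simpl. field. }
    destruct (HP O) as [P1 [P2 _]]. pose proof (Hu O) as Hu0. pose proof (Hv O) as Hv0.
    (* The point [(u, v)] lies in all the rectangles; the local estimate there contradicts the
       invariant as soon as a rectangle is small enough. *)
    destruct (loc u v ltac:(lra) ltac:(lra) eps He) as [delta [Hd K]].
    destruct (half_pow_small ((b - a) + (d - c)) delta Hd) as [n Hn].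
    assert (Hp : 0 < (/ 2) ^ n) by (apply pow_lt; lra).
    specialize (Hu n). specialize (Hv n). destruct (HP n) as [Q1 [Q2 Q3]].
    specialize (K (x1 n) (x2 n) (y1 n) (y2 n)).
    assert (0 <= (b - a) * (/ 2) ^ n) by (apply Rmult_le_pos; lra).
    assert (0 <= (d - c) * (/ 2) ^ n) by (apply Rmult_le_pos; lra).
    rewrite Rmult_plus_distr_r in Hn.
    enough (Cmod (I (x1 n) (x2 n) (y1 n) (y2 n)) <= eps * ((x2 n - x1 n) + (y2 n - y1 n)) ^ 2)
      by lra.
    apply K; try rewrite Wx; try rewrite Wy; lra.
Qed.

Lemma Ccontinuous_inv (F : R -> C) (x : R) :
  F x <> RtoC 0 -> Ccontinuous F x -> Ccontinuous (fun t => / F t)%C x.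
Proof.
  intros Hx [H1 H2].
  assert (HD : continuous (fun t => Re (F t) * (Re (F t) * 1) + Im (F t) * (Im (F t) * 1)) x).
  { apply (continuous_ext (fun t => Re (F t) * Re (F t) + Im (F t) * Im (F t))).
    - intros t. simpl. ring.
    - apply (continuous_plus (fun t => Re (F t) * Re (F t)) (fun t => Im (F t) * Im (F t)));
        now apply (continuous_mult (K := R_AbsRing)). }
  assert (HI : continuous (fun t =>
     / (Re (F t) * (Re (F t) * 1) + Im (F t) * (Im (F t) * 1))) x).
  { apply continuous_Rinv_comp; trivial. intros H0. apply Hx.
    unfold Re, Im in H0.
    pose proof (Rle_0_sqr (fst (F x))). pose proof (Rle_0_sqr (snd (F x))).
    apply injective_projections; simpl; apply Rsqr_0_uniq; unfold Rsqr in *; lra. }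
  split; simpl.
  - now apply (continuous_mult (K := R_AbsRing)).
  - apply (continuous_mult (K := R_AbsRing)); trivial.
    now apply (continuous_opp (V := R_NormedModule)).
Qed.

(** * Cauchy's formula *)

Definition cis (t : R) : C := (cos t, sin t).

Lemma Cmod_cis (t : R) : Cmod (cis t) = 1.
Proof.
  unfold Cmod, cis; simpl. pose proof (sin2_cos2 t) as H. unfold Rsqr in H.
  replace (cos t * (cos t * 1) + sin t * (sin t * 1)) with 1 by lra. exact sqrt_1.
Qed.

Lemma cis_neq_0 (t : R) : cis t <> RtoC 0.
Proof. apply Cmod_gt_0. rewrite Cmod_cis. lra. Qed.

Lemma Ccontinuous_cis (t : R) : Ccontinuous cis t.
Proof. split; simpl; [apply continuous_cos | apply continuous_sin]. Qed.

Lemma cis_lipschitz (t u : R) : Cmod (cis t - cis u)%C <= 2 * Rabs (t - u).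
Proof.
  eapply Rle_trans; [apply Cmod_le_Re_Im|]. simpl.
  assert (H : forall f f' : R -> R, (forall x, is_derive f x (f' x)) ->
    (forall x, Rabs (f' x) <= 1) -> Rabs (f t - f u) <= Rabs (t - u)).
  { intros f f' Hd Hb. destruct (MVT_gen f u t f') as [c [_ ->]].
    - intros x _. apply Hd.
    - intros x _. apply continuity_pt_filterlim, (ex_derive_continuous f).
      exists (f' x). apply Hd.
    - rewrite Rabs_mult. pose proof (Rabs_pos (t - u)). specialize (Hb c). nra. }
  pose proof (H cos (fun x => - sin x)) as Hc. pose proof (H sin cos) as Hs.
  assert (Rabs (cos t - cos u) <= Rabs (t - u)).
  { apply Hc; [exact is_derive_cos|]. intros x. rewrite Rabs_Ropp.
    apply Rabs_le, SIN_bound. }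
  assert (Rabs (sin t - sin u) <= Rabs (t - u)).
  { apply Hs; [exact is_derive_sin|]. intros x. apply Rabs_le, COS_bound. }
  unfold Rminus in *. lra.
Qed.

Lemma Cmod_RtoC_mult (r : R) (z : C) : 0 <= r -> Cmod (RtoC r * z)%C = r * Cmod z.
Proof. intros Hr. now rewrite Cmod_mult, Cmod_R, Rabs_pos_eq. Qed.

Lemma Cmod_triangle_minus (a b : C) : Cmod (a - b)%C <= Cmod a + Cmod b.
Proof. unfold Cminus. rewrite <- (Cmod_opp b). apply Cmod_triangle. Qed.

Lemma Cmod_minus_lower (a b : C) : Cmod a - Cmod b <= Cmod (a - b)%C.
Proof.
  pose proof (Cmod_triangle (a - b) b) as H.
  replace (a - b + b)%C with a in H by ring. lra.
Qed.

(** The vector [E(t)] from [a] to [r e^(it)]. In the coordinates [a + l E(t)] the circle is [l = 1],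
    and decreasing [l] contracts it to [a] along segments that stay in the disc. *)
Definition ray_to_circle (r : R) (a : C) (t : R) : C := (RtoC r * cis t - a)%C.

(** This is [E'(t) / E(t)], the pullback of [dw / (w - a)]. Scaling [E] by [l] does not change it,
    so one kernel serves all the contracted circles. *)
Definition cauchy_kernel (r : R) (a : C) (t : R) : C :=
  (RtoC r * Ci * cis t / ray_to_circle r a t)%C.

(** The shape shared by the decompositions below: two integrals with constant coefficients and a
    remainder left to be estimated. *)
Lemma CInt_combination (c1 c2 : C) (F1 F2 F3 G : R -> C) (x y : R) : x <= y ->
  Ccontinuous_on F1 x y -> Ccontinuous_on F2 x y -> Ccontinuous_on F3 x y ->
  (forall t, x <= t <= y -> G t = c1 * F1 t + c2 * F2 t + F3 t)%C ->
  CInt G x y = (c1 * CInt F1 x y + c2 * CInt F2 x y + CInt F3 x y)%C.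
Proof.
  intros Hxy H1 H2 H3 HG.
  assert (S : forall c F, Ccontinuous_on F x y -> Ccontinuous_on (fun t => c * F t)%C x y).
  { intros c F HF t Ht. apply Ccontinuous_mult; [apply Ccontinuous_const | now apply HF]. }
  rewrite (CInt_ext _ _ _ _ Hxy HG).
  rewrite (CInt_plus (fun t => c1 * F1 t + c2 * F2 t)%C F3); trivial.
  - rewrite (CInt_plus (fun t => c1 * F1 t)%C (fun t => c2 * F2 t)%C), !CInt_scal; auto.
  - intros t Ht. apply Ccontinuous_plus; now apply S.
Qed.

Section CauchyKernel.
Variables (r : R) (a : C).
Hypothesis Ha : Cmod a < r.
Let E := ray_to_circle r a.
Let W := cauchy_kernel r a.

Lemma ray_to_circle_lower (t : R) : r - Cmod a <= Cmod (E t).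
Proof.
  pose proof (Cmod_minus_lower (RtoC r * cis t) a) as H.
  pose proof (Cmod_ge_0 a). rewrite Cmod_RtoC_mult, Cmod_cis in H by lra.
  unfold E, ray_to_circle. lra.
Qed.

Lemma ray_to_circle_upper (t : R) : Cmod (E t) <= 2 * r.
Proof.
  pose proof (Cmod_triangle_minus (RtoC r * cis t) a) as H.
  pose proof (Cmod_ge_0 a). rewrite Cmod_RtoC_mult, Cmod_cis in H by lra.
  unfold E, ray_to_circle. lra.
Qed.

Lemma ray_to_circle_neq_0 (t : R) : E t <> RtoC 0.
Proof. apply Cmod_gt_0. pose proof (ray_to_circle_lower t). lra. Qed.

Lemma cauchy_kernel_bound (t : R) : Cmod (W t) <= r / (r - Cmod a).
Proof.
  pose proof (ray_to_circle_lower t) as H. pose proof (Cmod_ge_0 a).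
  unfold W, cauchy_kernel. fold E.
  rewrite Cmod_div by apply ray_to_circle_neq_0.
  rewrite !Cmod_mult, Cmod_Ci, Cmod_cis, Cmod_R, Rabs_pos_eq by lra.
  rewrite !Rmult_1_r. apply Rmult_le_compat_l; [lra|].
  apply Rinv_le_contravar; lra.
Qed.

Lemma Ccontinuous_ray_to_circle (t : R) : Ccontinuous E t.
Proof.
  apply Ccontinuous_minus; [|apply Ccontinuous_const].
  apply Ccontinuous_mult; [apply Ccontinuous_const | apply Ccontinuous_cis].
Qed.

Lemma Ccontinuous_cauchy_kernel (t : R) : Ccontinuous W t.
Proof.
  apply Ccontinuous_mult.
  - apply Ccontinuous_mult; [apply Ccontinuous_const | apply Ccontinuous_cis].
  - apply Ccontinuous_inv; [apply ray_to_circle_neq_0 | apply Ccontinuous_ray_to_circle].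
Qed.

Lemma CInt_kernel_ray (t1 t2 : R) : t1 <= t2 ->
  CInt (fun t => W t * E t)%C t1 t2 = (E t2 - E t1)%C.
Proof.
  intros Ht.
  rewrite (CInt_ext _ (fun t => RtoC r * Ci * cis t)%C); trivial.
  - apply CInt_derive; trivial.
    + intros t _. apply Ccontinuous_mult; [apply Ccontinuous_const | apply Ccontinuous_cis].
    + intros x. unfold E, ray_to_circle, cis. simpl. auto_derive; trivial. ring.
    + intros x. unfold E, ray_to_circle, cis. simpl. auto_derive; trivial. ring.
  - intros t _. unfold W, cauchy_kernel. fold E. field. apply ray_to_circle_neq_0.
Qed.

Lemma Cmod_segment_le (l t : R) : 0 <= l <= 1 -> Cmod (a + RtoC l * E t)%C <= r.
Proof.
  intros Hl. unfold E, ray_to_circle.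
  replace (a + RtoC l * (RtoC r * cis t - a))%C
    with (RtoC (1 - l) * a + RtoC l * (RtoC r * cis t))%C
    by (rewrite RtoC_minus; ring).
  eapply Rle_trans; [apply Cmod_triangle|]. pose proof (Cmod_ge_0 a).
  rewrite !Cmod_RtoC_mult, Cmod_cis by lra. nra.
Qed.

Lemma segment_lipschitz (l t u v : R) : 0 <= l <= 1 ->
  Cmod ((a + RtoC l * E t) - (a + RtoC u * E v))%C <= 2 * r * (Rabs (l - u) + Rabs (t - v)).
Proof.
  intros Hl.
  replace ((a + RtoC l * E t) - (a + RtoC u * E v))%C
    with (RtoC (l - u) * E v + RtoC l * (RtoC r * (cis t - cis v)))%C
    by (unfold E, ray_to_circle; rewrite RtoC_minus; ring).
  eapply Rle_trans; [apply Cmod_triangle|]. pose proof (Cmod_ge_0 a).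
  rewrite (Cmod_mult (RtoC (l - u))), Cmod_R, !Cmod_RtoC_mult by lra.
  pose proof (ray_to_circle_upper v). pose proof (cis_lipschitz t v).
  pose proof (Rabs_pos (l - u)). pose proof (Rabs_pos (t - v)).
  pose proof (Cmod_ge_0 (cis t - cis v)).
  assert (r * Cmod (cis t - cis v) <= r * (2 * Rabs (t - v))) by (apply Rmult_le_compat_l; lra).
  assert (0 <= r * Cmod (cis t - cis v)) by (apply Rmult_le_pos; lra).
  assert (Rabs (l - u) * Cmod (E v) <= Rabs (l - u) * (2 * r))
    by (apply Rmult_le_compat_l; lra).
  nra.
Qed.

(* Goursat's argument for the form [h(g) dg / (g - a)] pulled back along [g(l, t) = a + l E(t)]:
   its components are [h(g) / l] and [h(g) E'/E], and for affine [h] it integrates to zero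
   over the boundary of any rectangle. *)
Lemma kernel_integral_invariant (h : C -> C) (e : R) :
  (forall z, Cmod z <= r -> exists c, has_deriv h z c) -> 0 < e <= 1 ->
  CInt (fun t => h (a + RtoC 1 * E t) * W t)%C 0 (2 * PI) =
  CInt (fun t => h (a + RtoC e * E t) * W t)%C 0 (2 * PI).
Proof.
  intros Hh He. pose proof (Cmod_ge_0 a) as Ha0. pose proof PI_RGT_0 as HPI.
  pose (g := fun l t => (a + RtoC l * E t)%C).
  pose (q := fun l t => (h (g l t) * W t)%C).
  pose (p := fun t l => (h (g l t) * RtoC (/ l))%C).
  assert (Cg1 : forall l t, Ccontinuous (g l) t).
  { intros l t. apply Ccontinuous_plus; [apply Ccontinuous_const|].
    apply Ccontinuous_mult; [apply Ccontinuous_const | apply Ccontinuous_ray_to_circle]. }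
  assert (Cg2 : forall l t, Ccontinuous (fun l => g l t) l).
  { intros l t. apply Ccontinuous_plus; [apply Ccontinuous_const|].
    apply Ccontinuous_mult; [|apply Ccontinuous_const].
    apply Ccontinuous_RtoC, continuous_id. }
  assert (Ch1 : forall l t, 0 <= l <= 1 -> Ccontinuous (fun t => h (g l t)) t).
  { intros l t Hl. destruct (Hh (g l t)) as [c Hc]; [now apply Cmod_segment_le|].
    apply (Ccontinuous_comp _ _ _ c); trivial. }
  assert (Ch2 : forall l t, 0 <= l <= 1 -> Ccontinuous (fun l => h (g l t)) l).
  { intros l t Hl. destruct (Hh (g l t)) as [c Hc]; [now apply Cmod_segment_le|].
    apply (Ccontinuous_comp _ (fun l => g l t) _ c); trivial. }
  assert (CI2 : forall l, 0 < l -> Ccontinuous (fun l => RtoC (/ l)) l).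
  { intros l Hl. apply Ccontinuous_RtoC, continuous_Rinv. lra. }
  assert (Cq : forall l t, 0 <= l <= 1 -> Ccontinuous (q l) t).
  { intros l t Hl. apply Ccontinuous_mult; [now apply Ch1 | apply Ccontinuous_cauchy_kernel]. }
  assert (Cp : forall l t, 0 < l <= 1 -> Ccontinuous (p t) l).
  { intros l t Hl. apply Ccontinuous_mult; [apply Ch2; lra | apply CI2; lra]. }
  (* The integral of the form over the boundary of [[x1, x2] x [y1, y2]] in the [(l, t)] plane;
     contributions of a common side cancel, which is the additivity required. *)
  pose (I := fun x1 x2 y1 y2 =>
    (CInt (q x2) y1 y2 - CInt (q x1) y1 y2 - (CInt (p y2) x1 x2 - CInt (p y1) x1 x2))%C).
  assert (HI : I e 1 0 (2 * PI) = RtoC 0).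
  { apply additive_rectangle_function_zero; [lra|lra| | |].
    - intros x1 m x2 y1 y2 H1 H2 H3 H4. unfold I.
      rewrite (CInt_Chasles (p y2) x1 m x2), (CInt_Chasles (p y1) x1 m x2); try lra.
      + ring.
      + intros x Hx. apply Cp. lra.
      + intros x Hx. apply Cp. lra.
    - intros x1 x2 y1 m y2 H1 H2 H3 H4. unfold I.
      rewrite (CInt_Chasles (q x2) y1 m y2), (CInt_Chasles (q x1) y1 m y2); try lra.
      + ring.
      + intros x Hx. apply Cq. lra.
      + intros x Hx. apply Cq. lra.
    - intros u v Hu Hv eps Heps.
      destruct (Hh (g u v)) as [c Hc]; [apply Cmod_segment_le; lra|].
      (* [B] bounds both factors that multiply [h]: the kernel by [r / (r - |a|)] and [1 / l] by
         [1 / e]. The latter is why [l] stays above [e]. *)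
      pose (B := r / (r - Cmod a) + / e).
      assert (Hra : 0 < r / (r - Cmod a)) by (apply Rdiv_lt_0_compat; lra).
      assert (Hie : 0 < / e) by (apply Rinv_0_lt_compat; lra).
      assert (HrB : 0 < 16 * r * B) by (unfold B; nra).
      (* Points of the rectangle are within [2 * r * s] of [g u v], and [CInt_bound] costs a factor
         2, so with this constant each of the four sides contributes at most [eps * s ^ 2 / 4]. *)
      destruct (Hc (eps / (16 * r * B))) as [d [Hd K]].
      { apply Rdiv_lt_0_compat; lra. }
      exists (d / (4 * r)). split; [apply Rdiv_lt_0_compat; lra|].
      intros x1 x2 y1 y2 H1 H2 H3 H4 Hx Hy.
      set (s := (x2 - x1) + (y2 - y1)).
      assert (Hsd : 2 * r * s < d).
      { assert (Hsd : s < 2 * (d / (4 * r))) by (unfold s; lra).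
        apply (Rmult_lt_compat_l (2 * r)) in Hsd; [|lra].
        replace (2 * r * (2 * (d / (4 * r)))) with d in Hsd by (field; lra). exact Hsd. }
      pose (rho := fun l t => (h (g l t) - h (g u v) - c * (g l t - g u v))%C).
      assert (Hrho : forall l t, x1 <= l <= x2 -> y1 <= t <= y2 ->
        Cmod (rho l t) <= eps / (16 * r * B) * (2 * r * s)).
      { intros l t Hl Ht.
        assert (Hg : Cmod (g l t - g u v)%C <= 2 * r * s).
        { eapply Rle_trans; [apply segment_lipschitz; lra|].
          apply Rmult_le_compat_l; [lra|].
          assert (Rabs (l - u) <= x2 - x1) by (apply Rabs_le; lra).
          assert (Rabs (t - v) <= y2 - y1) by (apply Rabs_le; lra).
          unfold s. lra. }
        specialize (K (g l t - g u v)%C ltac:(lra)).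
        replace (g u v + (g l t - g u v))%C with (g l t) in K by ring.
        eapply Rle_trans; [exact K|]. apply Rmult_le_compat_l; [|exact Hg].
        apply Rlt_le, Rdiv_lt_0_compat; lra. }
      assert (Cr1 : forall l t, 0 <= l <= 1 -> Ccontinuous (rho l) t).
      { intros l t Hl. apply Ccontinuous_minus.
        - apply Ccontinuous_minus; [now apply Ch1 | apply Ccontinuous_const].
        - apply Ccontinuous_mult; [apply Ccontinuous_const|].
          apply Ccontinuous_minus; [apply Cg1 | apply Ccontinuous_const]. }
      assert (Cr2 : forall l t, 0 <= l <= 1 -> Ccontinuous (fun l => rho l t) l).
      { intros l t Hl. apply Ccontinuous_minus.
        - apply Ccontinuous_minus; [now apply Ch2 | apply Ccontinuous_const].
        - apply Ccontinuous_mult; [apply Ccontinuous_const|].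
          apply Ccontinuous_minus; [apply Cg2 | apply Ccontinuous_const]. }
      (* The affine approximation of [h] at [g u v], written around [a]: its value at [g l t] is
         [al + c * l * E t]. *)
      pose (al := (h (g u v) - c * (g u v - a))%C).
      assert (Iq : forall l, 0 <= l <= 1 -> CInt (q l) y1 y2 =
        (al * CInt W y1 y2 + c * RtoC l * (E y2 - E y1)
         + CInt (fun t => rho l t * W t) y1 y2)%C).
      { intros l Hl. rewrite <- CInt_kernel_ray by lra.
        apply CInt_combination; [lra| | | |].
        - intros t _. apply Ccontinuous_cauchy_kernel.
        - intros t _. apply Ccontinuous_mult;
            [apply Ccontinuous_cauchy_kernel | apply Ccontinuous_ray_to_circle].
        - intros t _. apply Ccontinuous_mult;
            [now apply Cr1 | apply Ccontinuous_cauchy_kernel].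
        - intros t _. unfold q, rho, al, g. ring. }
      assert (Ip : forall t, CInt (p t) x1 x2 =
        (al * CInt (fun l => RtoC (/ l)) x1 x2 + c * E t * (RtoC (x2 - x1) * RtoC 1)
         + CInt (fun l => rho l t * RtoC (/ l)) x1 x2)%C).
      { intros t. rewrite <- CInt_const.
        apply CInt_combination; [lra| | | |].
        - intros l Hl. apply CI2. lra.
        - intros l Hl. apply Ccontinuous_const.
        - intros l Hl. apply Ccontinuous_mult; [apply Cr2; lra | apply CI2; lra].
        - intros l Hl. unfold p, rho, al, g.
          rewrite RtoC_inv by lra. field. intros H0. apply RtoC_inj in H0. lra. }
      unfold I. rewrite !Iq, !Ip by lra.
      set (J1 := CInt (fun t => rho x2 t * W t)%C y1 y2).
      set (J2 := CInt (fun t => rho x1 t * W t)%C y1 y2).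
      set (J3 := CInt (fun l => rho l y2 * RtoC (/ l))%C x1 x2).
      set (J4 := CInt (fun l => rho l y1 * RtoC (/ l))%C x1 x2).
      (* The affine part cancels: the [al] terms agree on opposite sides, and
         [c * (x2 - x1) * (E y2 - E y1)] arises from both pairs of sides. *)
      match goal with |- Cmod ?X <= _ => replace X with ((J1 - J2) - (J3 - J4))%C
        by (rewrite RtoC_minus; ring) end.
      assert (HB : 0 < B) by (unfold B; lra).
      assert (Hs : 0 <= s) by (unfold s; lra).
      assert (He0 : 0 <= eps / (16 * r * B) * (2 * r * s)).
      { apply Rmult_le_pos; [|nra]. apply Rlt_le, Rdiv_lt_0_compat; lra. }
      assert (HJ : forall len J, 0 <= len <= s ->
        Cmod J <= 2 * (eps / (16 * r * B) * (2 * r * s) * B) * len ->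
        Cmod J <= eps * s ^ 2 / 4).
      { intros len J Hlen HJ. eapply Rle_trans; [exact HJ|].
        apply Rle_trans with (2 * (eps / (16 * r * B) * (2 * r * s) * B) * s).
        - apply Rmult_le_compat_l; [|lra]. nra.
        - apply Req_le. field. split; lra. }
      assert (HW : forall t, Cmod (W t) <= B).
      { intros t. pose proof (cauchy_kernel_bound t). unfold B. lra. }
      assert (HL : forall l, x1 <= l <= x2 -> Cmod (RtoC (/ l)) <= B).
      { intros l Hl. rewrite Cmod_R, Rabs_pos_eq.
        - assert (/ l <= / e) by (apply Rinv_le_contravar; lra). unfold B. lra.
        - apply Rlt_le, Rinv_0_lt_compat. lra. }
      assert (M : forall x y A B, Cmod x <= A -> Cmod y <= B -> Cmod (x * y)%C <= A * B).
      { intros x y A0 B0 HA HB0. rewrite Cmod_mult.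
        apply Rmult_le_compat; trivial; apply Cmod_ge_0. }
      assert (Cmod J1 <= eps * s ^ 2 / 4).
      { apply (HJ (y2 - y1)); [unfold s; lra|]. apply CInt_bound; [lra| |].
        - intros t Ht. apply Ccontinuous_mult;
            [apply Cr1; lra | apply Ccontinuous_cauchy_kernel].
        - intros t Ht. apply M; [apply Hrho; lra | apply HW]. }
      assert (Cmod J2 <= eps * s ^ 2 / 4).
      { apply (HJ (y2 - y1)); [unfold s; lra|]. apply CInt_bound; [lra| |].
        - intros t Ht. apply Ccontinuous_mult;
            [apply Cr1; lra | apply Ccontinuous_cauchy_kernel].
        - intros t Ht. apply M; [apply Hrho; lra | apply HW]. }
      assert (Cmod J3 <= eps * s ^ 2 / 4).
      { apply (HJ (x2 - x1)); [unfold s; lra|]. apply CInt_bound; [lra| |].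
        - intros l Hl. apply Ccontinuous_mult; [apply Cr2; lra | apply CI2; lra].
        - intros l Hl. apply M; [apply Hrho; lra | apply HL; lra]. }
      assert (Cmod J4 <= eps * s ^ 2 / 4).
      { apply (HJ (x2 - x1)); [unfold s; lra|]. apply CInt_bound; [lra| |].
        - intros l Hl. apply Ccontinuous_mult; [apply Cr2; lra | apply CI2; lra].
        - intros l Hl. apply M; [apply Hrho; lra | apply HL; lra]. }
      pose proof (Cmod_triangle_minus (J1 - J2) (J3 - J4)).
      pose proof (Cmod_triangle_minus J1 J2). pose proof (Cmod_triangle_minus J3 J4). lra. }
  unfold I in HI.
  (* The sides [t = 0] and [t = 2 PI] are the same segment, so only the two circles remain. *)
  assert (Hper : forall l, p (2 * PI) l = p 0 l).
  { intros l. unfold p, g, E, ray_to_circle, cis. now rewrite cos_2PI, sin_2PI, cos_0, sin_0. }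
  rewrite (CInt_ext (p (2 * PI)) (p 0)) in HI by (lra || (intros; apply Hper)).
  change (CInt (q 1) 0 (2 * PI) = CInt (q e) 0 (2 * PI)).
  replace (CInt (q 1) 0 (2 * PI)) with
    (CInt (q 1) 0 (2 * PI) - CInt (q e) 0 (2 * PI) - (CInt (p 0) e 1 - CInt (p 0) e 1)
      + CInt (q e) 0 (2 * PI))%C by ring.
  rewrite HI. ring.
Qed.
End CauchyKernel.

(** The index [n] is excluded, so the remainder after [n] terms of a power series begins with the
    power [n]. *)
Fixpoint Csum (u : nat -> C) (n : nat) : C :=
  match n with O => RtoC 0 | S k => (Csum u k + u k)%C end.

Lemma eq_of_Cmod_minus_le (x y : C) :
  (forall eps, 0 < eps -> Cmod (x - y)%C <= eps) -> x = y.
Proof.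
  intros H. assert (H0 : Cmod (x - y)%C = 0).
  { apply Rle_antisym; [|apply Cmod_ge_0]. apply Rnot_lt_le. intros Hp.
    specialize (H (Cmod (x - y)%C / 2) ltac:(lra)). lra. }
  apply Cmod_eq_0 in H0. replace x with ((x - y) + y)%C by ring. rewrite H0. ring.
Qed.

Lemma cis_plus (x y : R) : cis (x + y) = (cis x * cis y)%C.
Proof. unfold cis. rewrite cos_plus, sin_plus. apply injective_projections; simpl; ring. Qed.

Lemma cis_0 : cis 0 = RtoC 1.
Proof. unfold cis. now rewrite cos_0, sin_0. Qed.

Lemma cis_opp (t : R) : cis (- t) = (/ cis t)%C.
Proof.
  assert (H : (cis (- t) * cis t)%C = RtoC 1).
  { rewrite <- cis_plus. replace (- t + t) with 0 by ring. apply cis_0. }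
  replace (cis (- t)) with (cis (- t) * cis t * / cis t)%C
    by (field; apply cis_neq_0).
  rewrite H. ring.
Qed.

Lemma inv_circle_pow (r t : R) (n : nat) : r <> 0 ->
  ((/ (RtoC r * cis t)) ^ n)%C = (RtoC (/ r ^ n) * cis (- (INR n * t)))%C.
Proof.
  intros Hr. induction n as [|n IH].
  - simpl Cpow. replace (- (INR 0 * t)) with 0 by (simpl; ring). rewrite cis_0, <- RtoC_mult.
    f_equal. simpl. field.
  - rewrite Cpow_S, IH, S_INR.
    replace (- ((INR n + 1) * t)) with (- t + - (INR n * t)) by ring.
    rewrite cis_plus, (cis_opp t). simpl pow.
    rewrite Rinv_mult, RtoC_mult, (RtoC_inv r) by trivial.
    field. split.
    + apply cis_neq_0.
    + intros H. now apply RtoC_inj in H.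
Qed.

(** For [n >= 1] the integrand has a [2 PI]-periodic primitive, a multiple of [e^(-int)]. *)
Lemma CInt_inv_circle_pow (r : R) (n : nat) : r <> 0 -> (1 <= n)%nat ->
  CInt (fun t => Ci * (/ (RtoC r * cis t))^n)%C 0 (2 * PI) = RtoC 0.
Proof.
  intros Hr Hn. pose proof PI_RGT_0. assert (Hn0 : INR n <> 0) by (apply not_0_INR; lia).
  assert (Cc : forall t, Ccontinuous (fun t => cis (- (INR n * t))) t).
  { intros t. split; simpl.
    - apply continuous_comp; [|apply continuous_cos].
      apply (ex_derive_continuous (fun t => - (INR n * t))). auto_derive. trivial.
    - apply continuous_comp; [|apply continuous_sin].
      apply (ex_derive_continuous (fun t => - (INR n * t))). auto_derive. trivial. }
  rewrite (CInt_ext _ (fun t => RtoC (/ r ^ n) * (Ci * cis (- (INR n * t))))%C).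
  - rewrite CInt_scal; [|lra|].
    + rewrite (CInt_derive (fun t => RtoC (- / INR n) * cis (- (INR n * t)))%C).
      * replace (- (INR n * (2 * PI))) with (- (0 + 2 * INR n * PI)) by ring.
        unfold cis at 1. rewrite cos_neg, sin_neg, cos_period, sin_period.
        rewrite <- (cos_neg 0), <- sin_neg.
        replace (- (INR n * 0)) with (- 0) by ring. fold (cis (- 0)). ring.
      * lra.
      * intros t _. apply Ccontinuous_mult; [apply Ccontinuous_const | apply Cc].
      * intros x. simpl. auto_derive; trivial. now field.
      * intros x. simpl. auto_derive; trivial. now field.
    + intros t _. apply Ccontinuous_mult; [apply Ccontinuous_const | apply Cc].
  - lra.
  - intros t _. rewrite inv_circle_pow by trivial. ring.
Qed.

Section CauchyFormula.
Variables (r : R) (a : C).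
Hypothesis Ha : Cmod a < r.
Let E := ray_to_circle r a.
Let W := cauchy_kernel r a.

Lemma Ccontinuous_inv_circle_pow (n : nat) (t : R) :
  Ccontinuous (fun t => (/ (RtoC r * cis t))^n)%C t.
Proof.
  pose proof (Cmod_ge_0 a).
  apply Ccontinuous_pow, Ccontinuous_inv.
  - apply Cmod_gt_0. rewrite Cmod_RtoC_mult, Cmod_cis by lra. lra.
  - apply Ccontinuous_mult; [apply Ccontinuous_const | apply Ccontinuous_cis].
Qed.

(** One step of the geometric series for [1 / (w - a)], with [w = r e^(it)]:
    [1 / (w - a) = 1 / w + a / (w (w - a))], multiplied by [dw = i w dt]. Iterating it yields both
    the power expansion and its exact remainder. *)
Lemma cauchy_kernel_step (t : R) : W t = (Ci + a * / (RtoC r * cis t) * W t)%C.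
Proof.
  pose proof (ray_to_circle_neq_0 r a Ha t) as H. pose proof (Cmod_ge_0 a).
  unfold W, cauchy_kernel, ray_to_circle in *. field.
  repeat split; trivial.
  - apply cis_neq_0.
  - intros H'. apply RtoC_inj in H'. lra.
Qed.

Lemma kernel_integral_expansion (g : R -> C) (K : nat) :
  (forall t, Ccontinuous g t) ->
  CInt (fun t => g t * W t)%C 0 (2 * PI) =
  (Csum (fun n => a ^ n * CInt (fun t => g t * (Ci * (/ (RtoC r * cis t))^n)) 0 (2 * PI)) K
   + a ^ K * CInt (fun t => g t * ((/ (RtoC r * cis t))^K * W t)) 0 (2 * PI))%C.
Proof.
  intros Hg. pose proof PI_RGT_0 as HPI.
  induction K as [|K IH].
  - simpl Csum. rewrite (CInt_ext _ (fun t => g t * ((/ (RtoC r * cis t))^0 * W t))%C); [|lra|].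
    + simpl Cpow at 2. ring.
    + intros t _. simpl Cpow. ring.
  - rewrite IH. simpl Csum. rewrite <- Cplus_assoc. f_equal.
    set (X := fun t => (g t * (Ci * (/ (RtoC r * cis t))^K))%C).
    set (Y := fun t => (g t * ((/ (RtoC r * cis t))^(S K) * W t))%C).
    assert (HX : Ccontinuous_on X 0 (2 * PI)).
    { intros t _. apply Ccontinuous_mult; [apply Hg|].
      apply Ccontinuous_mult; [apply Ccontinuous_const | apply Ccontinuous_inv_circle_pow]. }
    assert (HY : Ccontinuous_on Y 0 (2 * PI)).
    { intros t _. apply Ccontinuous_mult; [apply Hg|].
      apply Ccontinuous_mult; [apply Ccontinuous_inv_circle_pow|].
      now apply Ccontinuous_cauchy_kernel. }
    rewrite (CInt_combination (RtoC 0) a (fun _ => RtoC 0) Y X); trivial; [|lra| |].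
    + rewrite Cpow_S. ring.
    + intros t _. apply Ccontinuous_const.
    + intros t _. unfold X, Y. rewrite cauchy_kernel_step at 1. rewrite Cpow_S. ring.
Qed.

Lemma kernel_integral_remainder (g : R -> C) (K : nat) (M : R) :
  (forall t, Ccontinuous g t) -> (forall t, Cmod (g t) <= M) ->
  Cmod (CInt (fun t => g t * W t)%C 0 (2 * PI) -
    Csum (fun n => a ^ n * CInt (fun t => g t * (Ci * (/ (RtoC r * cis t))^n)) 0 (2 * PI)) K)%C
  <= 4 * PI * M * (r / (r - Cmod a)) * (Cmod a / r) ^ K.
Proof.
  intros Hg HM. pose proof PI_RGT_0 as HPI. pose proof (Cmod_ge_0 a).
  rewrite (kernel_integral_expansion g K Hg).
  match goal with |- Cmod (?S + ?X - ?S)%C <= _ => replace (S + X - S)%C with X by ring end.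
  rewrite Cmod_mult, Cmod_pow.
  assert (HrK : 0 < / r ^ K) by (apply Rinv_0_lt_compat, pow_lt; lra).
  apply Rle_trans with (Cmod a ^ K * (2 * (M * (/ r ^ K * (r / (r - Cmod a)))) * (2 * PI - 0))).
  - apply Rmult_le_compat_l; [apply pow_le; lra|].
    apply CInt_bound; [lra| |].
    + intros t _. apply Ccontinuous_mult; [apply Hg|].
      apply Ccontinuous_mult; [apply Ccontinuous_inv_circle_pow|].
      now apply Ccontinuous_cauchy_kernel.
    + intros t _. rewrite !Cmod_mult.
      rewrite inv_circle_pow by lra. rewrite Cmod_RtoC_mult, Cmod_cis by lra.
      pose proof (cauchy_kernel_bound r a Ha t) as HW. fold W in HW.
      pose proof (Cmod_ge_0 (g t)). pose proof (Cmod_ge_0 (W t)).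
      apply Rmult_le_compat; trivial; [|rewrite Rmult_1_r; apply Rmult_le_compat_l; lra].
      rewrite Rmult_1_r. apply Rmult_le_pos; lra.
  - apply Req_le. unfold Rdiv at 3. rewrite Rpow_mult_distr, pow_inv. ring.
Qed.

(** The expansion for [g = 1] has only its term [n = 0], and the remainder tends to zero; the value
    [2 PI i] thus comes without a logarithm or a winding number. *)
Lemma CInt_cauchy_kernel : CInt W 0 (2 * PI) = (RtoC (2 * PI) * Ci)%C.
Proof.
  pose proof PI_RGT_0 as HPI. pose proof (Cmod_ge_0 a).
  assert (Hr : r <> 0) by lra.
  assert (S1 : forall K, Csum (fun n => a ^ n *
     CInt (fun t => RtoC 1 * (Ci * (/ (RtoC r * cis t))^n)) 0 (2 * PI))%C (S K)
     = (RtoC (2 * PI) * Ci)%C).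
  { intros K. induction K as [|K IH].
    - simpl Csum. rewrite (CInt_ext _ (fun t => Ci)); [|lra|].
      + rewrite CInt_const, Rminus_0_r. simpl Cpow. ring.
      + intros t _. simpl Cpow. ring.
    - change (Csum ?u (S (S K))) with (Csum u (S K) + u (S K))%C.
      rewrite IH. cbv beta.
      rewrite (CInt_ext _ (fun t => Ci * (/ (RtoC r * cis t))^(S K))%C); [|lra|].
      + rewrite CInt_inv_circle_pow by (trivial; lia). ring.
      + intros t _. ring. }
  apply eq_of_Cmod_minus_le. intros eps He.
  set (B := 4 * PI * 1 * (r / (r - Cmod a))).
  assert (HB : 0 < B).
  { unfold B. apply Rmult_lt_0_compat; [lra|]. apply Rdiv_lt_0_compat; lra. }
  assert (Hq : 0 <= Cmod a / r < 1).
  { split; [apply Rdiv_le_0_compat; lra|]. apply (Rmult_lt_reg_r r); [lra|].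
    unfold Rdiv. rewrite Rmult_assoc, Rinv_l; lra. }
  destruct (pow_lt_1_zero (Cmod a / r)) with (y := eps / B) as [K HK].
  { rewrite Rabs_pos_eq; lra. }
  { apply Rdiv_lt_0_compat; lra. }
  specialize (HK (S K) (le_S _ _ (le_n K))).
  rewrite Rabs_pos_eq in HK by (apply pow_le; lra).
  pose proof (kernel_integral_remainder (fun _ => RtoC 1) (S K) 1
    (fun t => Ccontinuous_const _ t) (fun _ => Req_le _ _ Cmod_1)) as HR.
  rewrite S1 in HR.
  rewrite (CInt_ext _ W) in HR by (lra || (intros; ring)).
  eapply Rle_trans; [exact HR|]. fold B.
  apply (Rmult_lt_compat_l B) in HK; [|lra].
  replace (B * (eps / B)) with eps in HK by (field; lra). lra.
Qed.

(** The integral does not change when the circle is contracted towards [a], where [h] is nearly the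
    constant [h a]; the integral of the kernel gives the factor. *)
Lemma cauchy_formula (h : C -> C) :
  (forall z, Cmod z <= r -> exists c, has_deriv h z c) ->
  CInt (fun t => h (RtoC r * cis t) * W t)%C 0 (2 * PI) = (h a * (RtoC (2 * PI) * Ci))%C.
Proof.
  intros Hh. pose proof PI_RGT_0 as HPI. pose proof (Cmod_ge_0 a) as Ha0.
  rewrite <- CInt_cauchy_kernel.
  rewrite (CInt_ext _ (fun t => h (a + RtoC 1 * E t) * W t)%C); [|lra|].
  2:{ intros t _. do 2 f_equal. unfold E, ray_to_circle. ring. }
  assert (CW : Ccontinuous_on W 0 (2 * PI)).
  { intros t _. now apply Ccontinuous_cauchy_kernel. }
  apply eq_of_Cmod_minus_le. intros eps He.
  assert (HB : 0 < r / (r - Cmod a)) by (apply Rdiv_lt_0_compat; lra).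
  set (B := r / (r - Cmod a)) in *.
  destruct (Hh a) as [c Hc]; [lra|].
  destruct (has_deriv_continuous _ _ _ Hc (eps / (4 * PI * B))) as [d [Hd K]].
  { apply Rdiv_lt_0_compat; nra. }
  (* Since [|E t| <= 2 r], the contracted circle lies within [e * 2 r < d] of [a]; the cap 1 keeps
     it in the disc. *)
  set (e := Rmin 1 (d / (4 * r))).
  assert (He1 : 0 < e <= 1).
  { split; [|apply Rmin_l]. apply Rmin_pos; [lra|]. apply Rdiv_lt_0_compat; lra. }
  assert (He2 : e * (2 * r) < d).
  { assert (H : e <= d / (4 * r)) by apply Rmin_r.
    apply (Rmult_le_compat_r (2 * r)) in H; [|lra].
    replace (d / (4 * r) * (2 * r)) with (d / 2) in H by (field; lra). lra. }
  pose proof (kernel_integral_invariant r a Ha h e Hh He1) as HI. fold E W in HI.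
  rewrite HI. clear HI.
  assert (Ch : forall t, Ccontinuous (fun t => h (a + RtoC e * E t)%C) t).
  { intros t. destruct (Hh (a + RtoC e * E t)%C) as [c' Hc'].
    - apply Cmod_segment_le; trivial. lra.
    - apply (Ccontinuous_comp h (fun t => a + RtoC e * E t)%C t c'); trivial.
      apply Ccontinuous_plus; [apply Ccontinuous_const|].
      apply Ccontinuous_mult; [apply Ccontinuous_const | apply Ccontinuous_ray_to_circle]. }
  assert (Cd : Ccontinuous_on (fun t => (h (a + RtoC e * E t) - h a) * W t)%C 0 (2 * PI)).
  { intros t Ht. apply Ccontinuous_mult; [|now apply CW].
    apply Ccontinuous_minus; [apply Ch | apply Ccontinuous_const]. }
  rewrite (CInt_combination (h a) (RtoC 0) W W
     (fun t => (h (a + RtoC e * E t) - h a) * W t)%C); trivial; [|lra|].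
  - match goal with |- Cmod ?X <= _ => replace X with
      (CInt (fun t => (h (a + RtoC e * E t) - h a) * W t) 0 (2 * PI))%C by ring end.
    eapply Rle_trans.
    + apply (CInt_bound _ 0 (2 * PI) (eps / (4 * PI * B) * B)); [lra|exact Cd|].
      intros t _. rewrite Cmod_mult. apply Rmult_le_compat; try apply Cmod_ge_0.
      * apply Rlt_le, K. replace (a + RtoC e * E t - a)%C with (RtoC e * E t)%C by ring.
        rewrite Cmod_RtoC_mult by lra.
        pose proof (ray_to_circle_upper r a Ha t) as HE. fold E in HE.
        eapply Rle_lt_trans; [|exact He2]. apply Rmult_le_compat_l; lra.
      * apply (cauchy_kernel_bound r a Ha t).
    + apply Req_le. field. split; lra.
  - intros t _. ring.
Qed.
End CauchyFormula.

(** * Power series *)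

Definition Cseries (u : nat -> C) (l : C) : Prop :=
  forall eps, 0 < eps -> exists n0, forall n, (n0 <= n)%nat -> Cmod (Csum u n - l)%C < eps.

Lemma Csum_ext (u v : nat -> C) (n : nat) :
  (forall k, u k = v k) -> Csum u n = Csum v n.
Proof. intros H. induction n as [|n IH]; simpl; [trivial|]. now rewrite IH, H. Qed.

Lemma Csum_plus (u v : nat -> C) (n : nat) :
  Csum (fun k => u k + v k)%C n = (Csum u n + Csum v n)%C.
Proof. induction n as [|n IH]; simpl; [ring|]. rewrite IH. ring. Qed.

Lemma Csum_scal (c : C) (u : nat -> C) (n : nat) :
  Csum (fun k => c * u k)%C n = (c * Csum u n)%C.
Proof. induction n as [|n IH]; simpl; [ring|]. rewrite IH. ring. Qed.

Lemma Cseries_ext (u v : nat -> C) (l : C) :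
  (forall k, u k = v k) -> Cseries u l -> Cseries v l.
Proof.
  intros H Hu eps He. destruct (Hu eps He) as [n0 Hn]. exists n0. intros n Hle.
  rewrite <- (Csum_ext u v n H). auto.
Qed.

Lemma Cseries_plus (u v : nat -> C) (l m : C) :
  Cseries u l -> Cseries v m -> Cseries (fun k => u k + v k)%C (l + m)%C.
Proof.
  intros Hu Hv eps He.
  destruct (Hu (eps / 2) ltac:(lra)) as [n1 H1]. destruct (Hv (eps / 2) ltac:(lra)) as [n2 H2].
  exists (n1 + n2)%nat. intros n Hn. rewrite Csum_plus.
  specialize (H1 n ltac:(lia)). specialize (H2 n ltac:(lia)).
  replace (Csum u n + Csum v n - (l + m))%C with ((Csum u n - l) + (Csum v n - m))%C by ring.
  eapply Rle_lt_trans; [apply Cmod_triangle|]. lra.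
Qed.

Lemma Cseries_scal (c : C) (u : nat -> C) (l : C) :
  Cseries u l -> Cseries (fun k => c * u k)%C (c * l)%C.
Proof.
  intros Hu eps He. pose proof (Cmod_ge_0 c).
  destruct (Hu (eps / (Cmod c + 1))) as [n0 H0]; [apply Rdiv_lt_0_compat; lra|].
  exists n0. intros n Hn. specialize (H0 n Hn). rewrite Csum_scal.
  replace (c * Csum u n - c * l)%C with (c * (Csum u n - l))%C by ring. rewrite Cmod_mult.
  apply (Rmult_lt_compat_r (Cmod c + 1)) in H0; [|lra].
  replace (eps / (Cmod c + 1) * (Cmod c + 1)) with eps in H0 by (field; lra).
  pose proof (Cmod_ge_0 (Csum u n - l)). nra.
Qed.

Lemma Cseries_dist (u : nat -> C) (l x : C) (B : R) (n1 : nat) :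
  Cseries u l -> (forall n, (n1 <= n)%nat -> Cmod (Csum u n - x)%C <= B) ->
  Cmod (l - x)%C <= B.
Proof.
  intros Hu HB. apply Rnot_lt_le. intros Hlt.
  destruct (Hu (Cmod (l - x)%C - B) ltac:(lra)) as [n0 H0].
  specialize (H0 (n0 + n1)%nat ltac:(lia)). specialize (HB (n0 + n1)%nat ltac:(lia)).
  rewrite Cmod_minus_sym in H0.
  pose proof (Cmod_triangle (l - Csum u (n0 + n1)) (Csum u (n0 + n1) - x)) as T.
  replace (l - Csum u (n0 + n1) + (Csum u (n0 + n1) - x))%C with (l - x)%C in T by ring. lra.
Qed.

Lemma Cseries_unique (u : nat -> C) (l m : C) : Cseries u l -> Cseries u m -> l = m.
Proof.
  intros Hl Hm. apply eq_of_Cmod_minus_le. intros eps He.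
  destruct (Hm eps He) as [n1 H1]. apply (Cseries_dist u l m eps n1 Hl).
  intros n Hn. apply Rlt_le, H1, Hn.
Qed.

Lemma geometric_tail (u : nat -> C) (A q : R) : 0 <= q < 1 ->
  (forall n, Cmod (u n) <= A * q ^ n) -> forall n k,
  Cmod (Csum u (n + k) - Csum u n)%C <= A * q ^ n / (1 - q).
Proof.
  intros Hq Hu n k.
  assert (HA : 0 <= A).
  { pose proof (Hu O) as H0. pose proof (Cmod_ge_0 (u O)). simpl in H0. lra. }
  (* The exact finite geometric sum lets the induction on [k] close; the factor [1 - q ^ k] is
     dropped afterwards. *)
  assert (H : Cmod (Csum u (n + k) - Csum u n)%C <= A * q ^ n * (1 - q ^ k) / (1 - q)).
  { induction k as [|k IH].
    - rewrite Nat.add_0_r. replace (Csum u n - Csum u n)%C with (RtoC 0) by ring.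
      rewrite Cmod_0. simpl. unfold Rdiv. lra.
    - rewrite Nat.add_succ_r. simpl Csum.
      replace (Csum u (n + k) + u (n + k)%nat - Csum u n)%C
        with ((Csum u (n + k) - Csum u n) + u (n + k)%nat)%C by ring.
      eapply Rle_trans; [apply Cmod_triangle|].
      specialize (Hu (n + k)%nat). rewrite pow_add in Hu.
      replace (A * q ^ n * (1 - q ^ S k) / (1 - q))
        with (A * q ^ n * (1 - q ^ k) / (1 - q) + A * (q ^ n * q ^ k)) by (simpl; field; lra).
      lra. }
  eapply Rle_trans; [exact H|]. apply Rmult_le_compat_r.
  - apply Rlt_le, Rinv_0_lt_compat. lra.
  - assert (0 <= q ^ k) by (apply pow_le; lra). assert (0 <= q ^ n) by (apply pow_le; lra).
    assert (0 <= A * q ^ n) by (apply Rmult_le_pos; lra). nra.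
Qed.

Lemma geometric_tail_small (A q eps : R) : 0 <= A -> 0 <= q < 1 -> 0 < eps ->
  exists n0, forall n, (n0 <= n)%nat -> A * q ^ n / (1 - q) < eps.
Proof.
  intros HA Hq He.
  destruct (pow_lt_1_zero q) with (y := eps * (1 - q) / (A + 1)) as [n0 H0].
  { rewrite Rabs_pos_eq; lra. }
  { apply Rdiv_lt_0_compat; [apply Rmult_lt_0_compat|]; lra. }
  exists n0. intros n Hn. specialize (H0 n Hn).
  assert (Hp : 0 <= q ^ n) by (apply pow_le; lra). rewrite Rabs_pos_eq in H0 by trivial.
  apply (Rmult_lt_compat_r (A + 1)) in H0; [|lra].
  replace (eps * (1 - q) / (A + 1) * (A + 1)) with (eps * (1 - q)) in H0 by (field; lra).
  apply (Rmult_lt_reg_r (1 - q)); [lra|].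
  replace (A * q ^ n / (1 - q) * (1 - q)) with (A * q ^ n) by (field; lra). nra.
Qed.

Lemma Cseries_of_geometric_error (u : nat -> C) (l : C) (A q : R) : 0 <= A -> 0 <= q < 1 ->
  (forall n, Cmod (Csum u n - l)%C <= A * q ^ n / (1 - q)) -> Cseries u l.
Proof.
  intros HA Hq H eps He. destruct (geometric_tail_small A q eps HA Hq He) as [n0 H0].
  exists n0. intros n Hn. eapply Rle_lt_trans; [apply H|auto].
Qed.

Lemma geometric_Cseries (u : nat -> C) (A q : R) : 0 <= q < 1 ->
  (forall n, Cmod (u n) <= A * q ^ n) -> exists l, Cseries u l.
Proof.
  intros Hq Hu.
  assert (HA : 0 <= A).
  { pose proof (Hu O) as H0. pose proof (Cmod_ge_0 (u O)). simpl in H0. lra. }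
  assert (Cau : forall eps, 0 < eps -> exists n0, forall n m, (n0 <= n)%nat -> (n0 <= m)%nat ->
    Cmod (Csum u n - Csum u m)%C < eps).
  { intros eps He. destruct (geometric_tail_small A q eps HA Hq He) as [n0 H0].
    exists n0.
    assert (W : forall n m, (n0 <= n)%nat -> (n <= m)%nat -> Cmod (Csum u m - Csum u n)%C < eps).
    { intros n m Hn Hm. replace m with (n + (m - n))%nat by lia.
      eapply Rle_lt_trans; [now apply geometric_tail|auto]. }
    intros n m Hn Hm. destruct (Nat.le_ge_cases n m) as [H|H].
    - rewrite Cmod_minus_sym. auto.
    - auto. }
  destruct (Rcomplete.R_complete (fun n => Re (Csum u n))) as [x Hx].
  { intros eps He. destruct (Cau eps He) as [n0 H0]. exists n0. intros n m Hn Hm.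
    eapply Rle_lt_trans; [apply (re_le_Cmod (Csum u n - Csum u m)%C)|auto]. }
  destruct (Rcomplete.R_complete (fun n => Im (Csum u n))) as [y Hy].
  { intros eps He. destruct (Cau eps He) as [n0 H0]. exists n0. intros n m Hn Hm.
    eapply Rle_lt_trans; [apply (im_le_Cmod (Csum u n - Csum u m)%C)|auto]. }
  exists (x, y). intros eps He.
  destruct (Hx (eps / 2)) as [n1 H1]; [lra|]. destruct (Hy (eps / 2)) as [n2 H2]; [lra|].
  exists (n1 + n2)%nat. intros n Hn.
  specialize (H1 n ltac:(lia)). specialize (H2 n ltac:(lia)).
  eapply Rle_lt_trans; [apply Cmod_le_Re_Im|].
  change (Rabs (Re (Csum u n) - x) + Rabs (Im (Csum u n) - y) < eps).
  unfold Rdist in *. lra.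
Qed.

Lemma geometric_Cseries_tail (u : nat -> C) (l : C) (A q : R) (n : nat) : 0 <= q < 1 ->
  (forall n, Cmod (u n) <= A * q ^ n) -> Cseries u l ->
  Cmod (l - Csum u n)%C <= A * q ^ n / (1 - q).
Proof.
  intros Hq Hu Hl. apply (Cseries_dist u l _ _ n Hl). intros m Hm.
  replace m with (n + (m - n))%nat by lia. now apply geometric_tail.
Qed.

Definition pterm (c : nat -> C) (z : C) : nat -> C := fun n => (c n * z ^ n)%C.

Lemma pterm_bound (c : nat -> C) (z : C) (M r : R) : 0 < r ->
  (forall n, Cmod (c n) <= M / r ^ n) ->
  forall n, Cmod (pterm c z n) <= M * (Cmod z / r) ^ n.
Proof.
  intros Hr Hc n. unfold pterm. rewrite Cmod_mult, Cmod_pow.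
  assert (0 <= Cmod z ^ n) by (apply pow_le, Cmod_ge_0).
  replace (M * (Cmod z / r) ^ n) with (M / r ^ n * Cmod z ^ n).
  - apply Rmult_le_compat_r; trivial.
  - unfold Rdiv. rewrite Rpow_mult_distr, pow_inv. ring.
Qed.

Lemma div_lt_1 (x r : R) : 0 <= x -> x < r -> 0 <= x / r < 1.
Proof.
  intros Hx Hr. split; [apply Rdiv_le_0_compat; lra|].
  apply (Rmult_lt_reg_r r); [lra|]. unfold Rdiv. rewrite Rmult_assoc, Rinv_l; lra.
Qed.

(** Expanding the kernel under Cauchy's integral gives the coefficients and a geometric remainder.
    The disc is closed because the integrals run over its boundary circle. *)
Lemma holomorphic_power_series_closed_disc (h : C -> C) (r M : R) : 0 < r ->
  (forall z, Cmod z <= r -> exists c, has_deriv h z c) ->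
  (forall z, Cmod z <= r -> Cmod (h z) <= M) ->
  exists c : nat -> C, (forall n, Cmod (c n) <= 2 * M / r ^ n) /\
    forall z, Cmod z < r -> Cseries (pterm c z) (h z).
Proof.
  intros Hr Hh HM. pose proof PI_RGT_0 as HPI.
  assert (Hcirc : forall t, Cmod (RtoC r * cis t)%C = r).
  { intros t. rewrite Cmod_RtoC_mult, Cmod_cis; lra. }
  assert (Hw : (RtoC (2 * PI) * Ci)%C <> RtoC 0).
  { apply Cmod_gt_0. rewrite Cmod_RtoC_mult, Cmod_Ci; lra. }
  assert (HwM : Cmod (RtoC (2 * PI) * Ci)%C = 2 * PI).
  { rewrite Cmod_RtoC_mult, Cmod_Ci; lra. }
  assert (Cg : forall t, Ccontinuous (fun t => h (RtoC r * cis t)%C) t).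
  { intros t. destruct (Hh (RtoC r * cis t)%C) as [c Hc]; [rewrite Hcirc; lra|].
    apply (Ccontinuous_comp h (fun t => RtoC r * cis t)%C t c); trivial.
    apply Ccontinuous_mult; [apply Ccontinuous_const | apply Ccontinuous_cis]. }
  assert (Mg : forall t, Cmod (h (RtoC r * cis t)%C) <= M).
  { intros t. apply HM. rewrite Hcirc. lra. }
  (* The integral of [h w / w^(n+1) dw]: the factor [Ci] and the missing power of [w] come from
     [dw = i w dt]. *)
  set (J := fun n => CInt (fun t => h (RtoC r * cis t) * (Ci * (/ (RtoC r * cis t))^n))%C
                       0 (2 * PI)).
  exists (fun n => (J n / (RtoC (2 * PI) * Ci))%C). split.
  - intros n. rewrite Cmod_div, HwM by trivial.
    assert (H0 : Cmod (RtoC 0) < r) by (rewrite Cmod_0; lra).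
    assert (HJ : Cmod (J n) <= 2 * (M * / r ^ n) * (2 * PI - 0)).
    { apply CInt_bound; [lra| |].
      - intros t _. apply Ccontinuous_mult; [apply Cg|]. apply Ccontinuous_mult.
        + apply Ccontinuous_const.
        + now apply (Ccontinuous_inv_circle_pow r (RtoC 0)).
      - intros t _. rewrite inv_circle_pow by lra.
        assert (0 < / r ^ n) by (apply Rinv_0_lt_compat, pow_lt; lra).
        rewrite !Cmod_mult, Cmod_Ci, Cmod_cis, Cmod_R, Rabs_pos_eq by lra.
        rewrite Rmult_1_l, Rmult_1_r. apply Rmult_le_compat_r; [lra|apply Mg]. }
    apply (Rmult_le_reg_r (2 * PI)); [lra|].
    replace (Cmod (J n) / (2 * PI) * (2 * PI)) with (Cmod (J n)) by (field; lra).
    unfold Rdiv. lra.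
  - intros z Hz. pose proof (Cmod_ge_0 z) as Hz0.
    pose proof (div_lt_1 _ _ Hz0 Hz) as Hq.
    (* The last factor only cancels the [1 - q] that [Cseries_of_geometric_error] expects as a
       denominator. *)
    set (B := 4 * PI * M * (r / (r - Cmod z)) / (2 * PI) * (1 - Cmod z / r)).
    assert (HM0 : 0 <= M) by (eapply Rle_trans; [apply Cmod_ge_0|apply (Mg 0)]).
    assert (0 < r / (r - Cmod z)) by (apply Rdiv_lt_0_compat; lra).
    apply (Cseries_of_geometric_error _ _ B (Cmod z / r)); trivial.
    + unfold B. apply Rmult_le_pos; [|lra]. apply Rdiv_le_0_compat; [|lra].
      apply Rmult_le_pos; [|lra]. apply Rmult_le_pos; lra.
    + intros n.
      pose proof (kernel_integral_remainder r z Hz (fun t => h (RtoC r * cis t)%C) n M Cg Mg)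
        as HR.
      cbv beta in HR. rewrite (cauchy_formula r z Hz h Hh) in HR.
      rewrite (Csum_ext _ (fun k => (RtoC (2 * PI) * Ci) *
         pterm (fun n => J n / (RtoC (2 * PI) * Ci)) z k)%C) in HR.
      * rewrite Csum_scal in HR.
        match type of HR with Cmod (?hz * ?w - ?w * ?S)%C <= _ =>
          replace (hz * w - w * S)%C with (w * (hz - S))%C in HR by ring end.
        rewrite Cmod_mult, HwM, Cmod_minus_sym in HR.
        apply (Rmult_le_reg_l (2 * PI)); [lra|]. eapply Rle_trans; [exact HR|].
        apply Req_le. unfold B. field. repeat split; lra.
      * intros k. unfold pterm. fold (J k). field. split.
        -- intros H'. apply (f_equal Cmod) in H'. rewrite Cmod_Ci, Cmod_0 in H'. lra.
        -- intros H'. apply RtoC_inj in H'. lra.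
Qed.

(** If the coefficients below [n] vanish, then [|c n| t^n] is at most [K t^m] plus a tail of order
    [t^(n+1)]; dividing by [t^n] and letting [t] tend to 0 kills [c n]. Only small positive real [t]
    occur, and this is how information on the real line reaches the complex disc. *)
Lemma power_series_order (c : nat -> C) (H : R -> C) (M r eta K : R) (m : nat) :
  0 < r -> 0 < eta -> (forall n, Cmod (c n) <= M / r ^ n) ->
  (forall t, 0 < t < eta -> Cseries (pterm c (RtoC t)) (H t)) ->
  (forall t, 0 < t < eta -> Cmod (H t) <= K * t ^ m) ->
  forall n, (n < m)%nat -> c n = RtoC 0.
Proof.
  intros Hr Heta Hc Hs HK.
  assert (HM : 0 <= M).
  { pose proof (Hc O) as H0. pose proof (Cmod_ge_0 (c O)). simpl in H0. lra. }
  intros n. induction n as [n IH] using (well_founded_induction Nat.lt_wf_0). intros Hnm.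
  (* For [t <= 1] the term [K t^m] is at most [|K| t^(n+1)]; for [t <= r / 2] the geometric tail is
     at most twice its first term. *)
  set (B := Rabs K + 2 * M / r ^ S n).
  assert (Hrn : 0 < r ^ S n) by (apply pow_lt; lra).
  assert (HB : 0 <= B).
  { unfold B. pose proof (Rabs_pos K). assert (0 <= 2 * M / r ^ S n); [|lra].
    apply Rdiv_le_0_compat; lra. }
  assert (Z : forall k, (k <= n)%nat -> forall z, Csum (pterm c z) k = RtoC 0).
  { intros k. induction k as [|k IHk]; intros Hk z; simpl; trivial.
    rewrite IHk by lia. unfold pterm. rewrite (IH k) by lia. ring. }
  assert (Bd : forall t, 0 < t -> t < eta -> t <= 1 -> t <= r / 2 -> Cmod (c n) <= B * t).
  { intros t Ht0 Ht1 Ht2 Ht3.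
    assert (Hmt : Cmod (RtoC t) = t) by (rewrite Cmod_R, Rabs_pos_eq; lra).
    pose proof (div_lt_1 t r ltac:(lra) ltac:(lra)) as Hq.
    pose proof (pterm_bound c (RtoC t) M r Hr Hc) as Hu. rewrite Hmt in Hu.
    pose proof (geometric_Cseries_tail _ _ _ _ (S n) Hq Hu (Hs t (conj Ht0 Ht1))) as T.
    simpl Csum in T. rewrite Z in T by lia.
    assert (T' : Cmod (pterm c (RtoC t) n) <= K * t ^ m + M * (t / r) ^ S n / (1 - t / r)).
    { pose proof (Cmod_triangle_minus (H t) (H t - (RtoC 0 + pterm c (RtoC t) n))) as T2.
      replace (H t - (H t - (RtoC 0 + pterm c (RtoC t) n)))%C with (pterm c (RtoC t) n)
        in T2 by ring.
      specialize (HK t (conj Ht0 Ht1)). lra. }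
    unfold pterm in T'. rewrite Cmod_mult, Cmod_pow, Hmt in T'.
    assert (Htn : 0 < t ^ n) by (apply pow_lt; lra).
    apply (Rmult_le_reg_r (t ^ n)); [lra|]. eapply Rle_trans; [exact T'|].
    unfold B. replace ((Rabs K + 2 * M / r ^ S n) * t * t ^ n)
      with (Rabs K * t ^ S n + M * (t / r) ^ S n * 2)
      by (unfold Rdiv; rewrite Rpow_mult_distr, pow_inv; simpl; ring).
    apply Rplus_le_compat.
    - apply Rle_trans with (Rabs K * t ^ m).
      + apply Rmult_le_compat_r; [apply pow_le; lra|apply Rle_abs].
      + apply Rmult_le_compat_l; [apply Rabs_pos|].
        replace m with (S n + (m - S n))%nat by lia. rewrite pow_add.
        assert (0 < t ^ S n) by (apply pow_lt; lra).
        assert (t ^ (m - S n) <= 1 ^ (m - S n)) by (apply pow_incr; lra).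
        rewrite pow1 in *. nra.
    - unfold Rdiv at 1. apply Rmult_le_compat_l.
      + apply Rmult_le_pos; trivial. apply pow_le. lra.
      + replace 2 with (/ (1 / 2)) by lra. apply Rinv_le_contravar; [lra|].
        assert (t / r <= 1 / 2); [|lra]. apply (Rmult_le_reg_r r); [lra|].
        replace (t / r * r) with t by (field; lra). lra. }
  apply Cmod_eq_0. apply Rle_antisym; [|apply Cmod_ge_0]. apply Rnot_lt_le. intros Hp.
  (* The last entry makes [B * t] smaller than [|c n|], against the bound just proved. *)
  set (t := Rmin (Rmin (eta / 2) 1) (Rmin (r / 2) (Cmod (c n) / (2 * (B + 1))))).
  assert (Ht : 0 < t).
  { unfold t. repeat apply Rmin_pos; try lra. apply Rdiv_lt_0_compat; lra. }
  assert (t <= eta / 2 /\ t <= 1 /\ t <= r / 2 /\ t <= Cmod (c n) / (2 * (B + 1)))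
    as (L1 & L2 & L3 & L4).
  { unfold t. pose proof (Rmin_l (eta / 2) 1). pose proof (Rmin_r (eta / 2) 1).
    pose proof (Rmin_l (r / 2) (Cmod (c n) / (2 * (B + 1)))).
    pose proof (Rmin_r (r / 2) (Cmod (c n) / (2 * (B + 1)))).
    pose proof (Rmin_l (Rmin (eta / 2) 1) (Rmin (r / 2) (Cmod (c n) / (2 * (B + 1))))).
    pose proof (Rmin_r (Rmin (eta / 2) 1) (Rmin (r / 2) (Cmod (c n) / (2 * (B + 1))))).
    lra. }
  specialize (Bd t Ht ltac:(lra) L2 L3).
  apply (Rmult_le_compat_l (2 * (B + 1))) in L4; [|lra].
  replace (2 * (B + 1) * (Cmod (c n) / (2 * (B + 1)))) with (Cmod (c n)) in L4 by (field; lra).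
  nra.
Qed.

(** The difference of the series has sum zero, hence satisfies [power_series_order] for every
    order. *)
Lemma power_series_unique (c d : nat -> C) (H : C -> C) (M M' r : R) : 0 < r ->
  (forall n, Cmod (c n) <= M / r ^ n) -> (forall n, Cmod (d n) <= M' / r ^ n) ->
  (forall z, Cmod z < r -> Cseries (pterm c z) (H z)) ->
  (forall z, Cmod z < r -> Cseries (pterm d z) (H z)) -> forall n, c n = d n.
Proof.
  intros Hr Hc Hd Sc Sd n.
  assert (E : (c n + RtoC (-1) * d n)%C = RtoC 0).
  { apply (power_series_order (fun n => c n + RtoC (-1) * d n)%C (fun _ => RtoC 0)
      (M + M') r r 0 (S n)); trivial; [| | |lia].
    - intros k. eapply Rle_trans; [apply Cmod_triangle|]. rewrite Cmod_mult, Cmod_R.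
      replace (Rabs (-1)) with 1 by (rewrite Rabs_left; lra).
      specialize (Hc k). specialize (Hd k). unfold Rdiv in *. lra.
    - intros t Ht. assert (Hm : Cmod (RtoC t) < r) by (rewrite Cmod_R, Rabs_pos_eq; lra).
      apply (Cseries_ext (fun k => pterm c (RtoC t) k + RtoC (-1) * pterm d (RtoC t) k)%C).
      + intros k. unfold pterm. ring.
      + replace (RtoC 0) with (H (RtoC t) + RtoC (-1) * H (RtoC t))%C by ring.
        apply Cseries_plus; [auto|]. apply Cseries_scal. auto.
    - intros t _. rewrite Cmod_0. lra. }
  replace (c n) with ((c n + RtoC (-1) * d n) + d n)%C by ring. rewrite E. ring.
Qed.

Lemma bound_div_pow_mono (x M r s : R) (n : nat) : 0 < r <= s -> 0 <= M ->
  x <= M / s ^ n -> x <= M / r ^ n.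
Proof.
  intros Hr HM Hx. eapply Rle_trans; [exact Hx|]. apply Rmult_le_compat_l; trivial.
  apply Rinv_le_contravar; [apply pow_lt; lra|]. apply pow_incr. lra.
Qed.

(** Uniqueness identifies the coefficients found on different closed subdiscs, so one sequence
    represents [h] on the whole open disc, whatever happens at its boundary. *)
Lemma holomorphic_power_series (h : C -> C) (R0 M : R) : 0 < R0 ->
  (forall z, Cmod z < R0 -> exists c, has_deriv h z c) ->
  (forall z, Cmod z < R0 -> Cmod (h z) <= M) ->
  exists c : nat -> C, (forall r n, 0 < r < R0 -> Cmod (c n) <= 2 * M / r ^ n) /\
    forall z, Cmod z < R0 -> Cseries (pterm c z) (h z).
Proof.
  intros HR Hh HM.
  assert (HM0 : 0 <= M).
  { eapply Rle_trans; [apply Cmod_ge_0|apply (HM (RtoC 0))]. rewrite Cmod_0. lra. }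
  assert (P : forall r, 0 < r < R0 -> exists c : nat -> C,
    (forall n, Cmod (c n) <= 2 * M / r ^ n) /\
    forall z, Cmod z < r -> Cseries (pterm c z) (h z)).
  { intros r Hr. apply holomorphic_power_series_closed_disc; [lra| |].
    - intros z Hz. apply Hh. lra.
    - intros z Hz. apply HM. lra. }
  destruct (P (R0 / 2) ltac:(lra)) as [c [Hc Sc]].
  assert (Q : forall r, 0 < r < R0 -> (forall n, Cmod (c n) <= 2 * M / r ^ n) /\
    forall z, Cmod z < r -> Cseries (pterm c z) (h z)).
  { intros r Hr. destruct (P r Hr) as [d [Hd Sd]].
    assert (E : forall n, c n = d n).
    { pose proof (Rmin_l r (R0 / 2)). pose proof (Rmin_r r (R0 / 2)).
      assert (0 < Rmin r (R0 / 2)) by (apply Rmin_pos; lra).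
      apply (power_series_unique c d h (2 * M) (2 * M) (Rmin r (R0 / 2))); trivial.
      - intros n. apply (bound_div_pow_mono _ _ _ (R0 / 2)); auto; lra.
      - intros n. apply (bound_div_pow_mono _ _ _ r); auto; lra.
      - intros z Hz. apply Sc. lra.
      - intros z Hz. apply Sd. lra. }
    split.
    - intros n. rewrite E. auto.
    - intros z Hz. apply (Cseries_ext (pterm d z)); [|auto].
      intros k. unfold pterm. now rewrite E. }
  exists c. split.
  - intros r n Hr. now apply Q.
  - intros z Hz. pose proof (Cmod_ge_0 z). apply (Q ((Cmod z + R0) / 2)); lra.
Qed.

(** * Differentiation of power series and the operator z d/dz *)

(** The second-order Taylor remainder of the power function. At [n = 0] the truncated [pred n] is
    harmless, being multiplied by [INR 0]. *)
Definition pow_increment (z w : C) (n : nat) : C :=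
  ((z + w)^n - z^n - RtoC (INR n) * z^(pred n) * w)%C.

(** The same polynomial in real variables; its coefficients are nonnegative, so it serves as a
    majorant. *)
Definition pow_increment_R (x y : R) (n : nat) : R :=
  (x + y) ^ n - x ^ n - INR n * x ^ (pred n) * y.

Lemma pow_increment_S (z w : C) (n : nat) : pow_increment z w (S n) =
  ((z + w) * pow_increment z w n + RtoC (INR n) * z^(pred n) * (w * w))%C.
Proof.
  unfold pow_increment. rewrite S_INR, RtoC_plus.
  destruct n as [|n]; simpl pred; rewrite ?Cpow_S; simpl; ring.
Qed.

Lemma pow_increment_R_S (x y : R) (n : nat) : pow_increment_R x y (S n) =
  (x + y) * pow_increment_R x y n + INR n * x ^ (pred n) * (y * y).
Proof.
  unfold pow_increment_R. rewrite S_INR.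
  destruct n as [|n]; simpl pred; simpl; ring.
Qed.

Lemma pow_increment_R_nonneg (x y : R) (n : nat) : 0 <= x -> 0 <= y -> 0 <= pow_increment_R x y n.
Proof.
  intros Hx Hy. induction n as [|n IH].
  - unfold pow_increment_R. simpl. lra.
  - rewrite pow_increment_R_S. apply Rplus_le_le_0_compat.
    + apply Rmult_le_pos; lra.
    + apply Rmult_le_pos; [|nra]. apply Rmult_le_pos; [apply pos_INR|now apply pow_le].
Qed.

(* Both sides satisfy the same recursion in [n], so the bound propagates without any
   combinatorics. *)
Lemma pow_increment_bound (z w : C) (s : R) (n : nat) : 0 < s -> Cmod w <= s ->
  Cmod (pow_increment z w n) * (s * s) <= Cmod w * Cmod w * (Cmod z + s) ^ n.
Proof.
  intros Hs Hw. pose proof (Cmod_ge_0 z) as Hz. pose proof (Cmod_ge_0 w) as Hw0.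
  apply Rle_trans with (Cmod w * Cmod w * pow_increment_R (Cmod z) s n).
  - induction n as [|n IH].
    + unfold pow_increment, pow_increment_R. simpl.
      replace (1 - 1 - 0 * 1 * w)%C with (RtoC 0) by ring. rewrite Cmod_0. lra.
    + rewrite pow_increment_S, pow_increment_R_S.
      pose proof (Cmod_triangle ((z + w) * pow_increment z w n)
        (RtoC (INR n) * z ^ pred n * (w * w))) as T.
      rewrite !Cmod_mult, Cmod_pow, Cmod_R, (Rabs_pos_eq (INR n)) in T by apply pos_INR.
      pose proof (Cmod_triangle z w) as T2. pose proof (Cmod_ge_0 (pow_increment z w n)).
      set (X := INR n * Cmod z ^ pred n) in *.
      assert (Cmod (z + w) * Cmod (pow_increment z w n)
              <= (Cmod z + s) * Cmod (pow_increment z w n))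
        by (apply Rmult_le_compat_r; lra).
      apply Rle_trans with
        (((Cmod z + s) * Cmod (pow_increment z w n) + X * (Cmod w * Cmod w)) * (s * s)).
      * apply Rmult_le_compat_r; [nra|lra].
      * assert ((Cmod z + s) * (Cmod (pow_increment z w n) * (s * s)) <=
                (Cmod z + s) * (Cmod w * Cmod w * pow_increment_R (Cmod z) s n))
          by (apply Rmult_le_compat_l; lra).
        lra.
  - apply Rmult_le_compat_l; [nra|]. unfold pow_increment_R.
    assert (0 <= Cmod z ^ n) by now apply pow_le.
    assert (0 <= INR n * Cmod z ^ pred n * s).
    { apply Rmult_le_pos; [|lra]. apply Rmult_le_pos; [apply pos_INR|now apply pow_le]. }
    lra.
Qed.

(** The linear term of the binomial expansion. It absorbs the factor [n] of a differentiated series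
    at the price of enlarging [x] to [x + s]. *)
Lemma INR_pow_pred_bound (x s : R) (n : nat) : 0 <= x -> 0 <= s ->
  INR n * x ^ pred n * s <= (x + s) ^ n.
Proof.
  intros Hx Hs. pose proof (pow_increment_R_nonneg x s n Hx Hs) as H.
  unfold pow_increment_R in H. assert (0 <= x ^ n) by now apply pow_le. lra.
Qed.

Lemma has_deriv_of_quadratic_bound (h : C -> C) (z c : C) (B d : R) : 0 < d ->
  (forall w, Cmod w < d -> Cmod (h (z + w) - h z - c * w)%C <= B * (Cmod w * Cmod w)) ->
  has_deriv h z c.
Proof.
  intros Hd HB eps He. pose proof (Rabs_pos B) as HB0.
  exists (Rmin d (eps / (Rabs B + 1))). split.
  { apply Rmin_pos; trivial. apply Rdiv_lt_0_compat; lra. }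
  intros w Hw. pose proof (Cmod_ge_0 w).
  specialize (HB w (Rlt_le_trans _ _ _ Hw (Rmin_l _ _))).
  apply Rlt_le_trans with (2 := Rmin_r _ _) in Hw.
  apply (Rmult_lt_compat_r (Rabs B + 1)) in Hw; [|lra].
  replace (eps / (Rabs B + 1) * (Rabs B + 1)) with eps in Hw by (field; lra).
  eapply Rle_trans; [exact HB|]. rewrite <- Rmult_assoc. apply Rmult_le_compat_r; trivial.
  pose proof (Rle_abs B). nra.
Qed.

(** The termwise second-order remainders add up to a bound quadratic in [w], which makes the sum
    differentiable. The series of the derivative is returned as well, so that a differential
    equation can be checked on coefficients. *)
Lemma power_series_has_deriv (c : nat -> C) (S0 : C -> C) (M r : R) (z : C) :
  Cmod z < r -> (forall n, Cmod (c n) <= M / r ^ n) ->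
  (forall z, Cmod z < r -> Cseries (pterm c z) (S0 z)) ->
  exists d, has_deriv S0 z d /\
    Cseries (fun n => c n * (RtoC (INR n) * z ^ pred n))%C d.
Proof.
  intros Hz Hc HS. pose proof (Cmod_ge_0 z) as Hz0.
  assert (HM : 0 <= M).
  { pose proof (Hc O) as H0. pose proof (Cmod_ge_0 (c O)). simpl in H0. lra. }
  (* Half the distance to the boundary: increments up to [s] remain in the disc, and all the series
     below are dominated by powers of [q < 1]. *)
  set (s := (r - Cmod z) / 2). assert (Hs : 0 < s) by (unfold s; lra).
  set (q := (Cmod z + s) / r).
  assert (Hq : 0 <= q < 1) by (apply div_lt_1; unfold s; lra).
  assert (Hqn : forall n X Y, 0 <= X -> X <= Y * (Cmod z + s) ^ n ->
    Cmod (c n) * X <= M * Y * q ^ n).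
  { intros n X Y HX H.
    assert (Hrn : 0 < / r ^ n) by (apply Rinv_0_lt_compat, pow_lt; lra).
    replace (M * Y * q ^ n) with (M / r ^ n * (Y * (Cmod z + s) ^ n))
      by (unfold q, Rdiv; rewrite Rpow_mult_distr, pow_inv; ring).
    apply Rmult_le_compat; trivial. apply Cmod_ge_0. }
  set (u := fun n => (c n * (RtoC (INR n) * z ^ pred n))%C).
  assert (Hu : forall n, Cmod (u n) <= M * / s * q ^ n).
  { intros n. unfold u. rewrite !Cmod_mult, Cmod_pow, Cmod_R, Rabs_pos_eq by apply pos_INR.
    apply Hqn.
    - apply Rmult_le_pos; [apply pos_INR|now apply pow_le].
    - apply (Rmult_le_reg_r s); trivial.
      replace (/ s * (Cmod z + s) ^ n * s) with ((Cmod z + s) ^ n) by (field; lra).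
      apply INR_pow_pred_bound; lra. }
  destruct (geometric_Cseries u _ q Hq Hu) as [d Hd].
  exists d. split; [|exact Hd].
  apply (has_deriv_of_quadratic_bound _ _ _ (M * / (s * s) / (1 - q)) s Hs).
  intros w Hw. pose proof (Cmod_ge_0 w) as Hw0.
  assert (Hzw : Cmod (z + w)%C < r).
  { eapply Rle_lt_trans; [apply Cmod_triangle|]. unfold s in Hw. lra. }
  assert (HT : Cseries (fun n => c n * pow_increment z w n)%C (S0 (z + w) - S0 z - d * w)%C).
  { apply (Cseries_ext (fun n =>
      (pterm c (z + w) n + RtoC (-1) * pterm c z n) + (RtoC (-1) * w) * u n)%C).
    - intros n. unfold pterm, u, pow_increment. ring.
    - replace (S0 (z + w) - S0 z - d * w)%C
        with ((S0 (z + w) + RtoC (-1) * S0 z) + (RtoC (-1) * w) * d)%C by ring.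
      apply Cseries_plus; [apply Cseries_plus|]; try apply Cseries_scal; auto. }
  assert (HB : forall n, Cmod (c n * pow_increment z w n)%C
     <= (M * (Cmod w * Cmod w * / (s * s))) * q ^ n).
  { intros n. rewrite Cmod_mult. apply Hqn; [apply Cmod_ge_0|].
    apply (Rmult_le_reg_r (s * s)); [nra|].
    replace (Cmod w * Cmod w * / (s * s) * (Cmod z + s) ^ n * (s * s))
      with (Cmod w * Cmod w * (Cmod z + s) ^ n) by (field; lra).
    apply pow_increment_bound; lra. }
  pose proof (geometric_Cseries_tail _ _ _ _ O Hq HB HT) as T. simpl Csum in T.
  replace (S0 (z + w) - S0 z - d * w - 0)%C with (S0 (z + w) - S0 z - d * w)%C in T by ring.
  eapply Rle_trans; [exact T|]. simpl. apply Req_le. field. lra.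
Qed.

Lemma Cseries_pterm_0 (c : nat -> C) : Cseries (pterm c (RtoC 0)) (c O).
Proof.
  intros eps He. exists 1%nat. intros n Hn.
  assert (E : Csum (pterm c (RtoC 0)) n = c O).
  { destruct n as [|n]; [lia|]. clear Hn. induction n as [|n IH].
    - simpl. unfold pterm. simpl. ring.
    - change (Csum ?u (S (S n))) with (Csum u (S n) + u (S n))%C. rewrite IH.
      unfold pterm. rewrite Cpow_S. ring. }
  rewrite E. replace (c O - c O)%C with (RtoC 0) by ring. now rewrite Cmod_0.
Qed.

(** The operator [z d/dz] multiplies the coefficient of [z^n] by [n]. At [n = 0] this forces
    [h 0 = 0] and leaves a free constant, set to zero. As [|d n| <= |c n|], the primitive exists on
    the same disc, so the iteration never loses domain. *)
Lemma euler_primitive (h : C -> C) (R0 M : R) : 0 < R0 ->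
  (forall z, Cmod z < R0 -> exists c, has_deriv h z c) ->
  (forall z, Cmod z < R0 -> Cmod (h z) <= M) -> h (RtoC 0) = RtoC 0 ->
  exists H : C -> C, H (RtoC 0) = RtoC 0 /\
    forall z, Cmod z < R0 -> exists c, has_deriv H z c /\ (z * c)%C = h z.
Proof.
  intros HR Hh HM Hh0.
  destruct (holomorphic_power_series h R0 M HR Hh HM) as [c [Hc Sc]].
  assert (HM0 : 0 <= M).
  { eapply Rle_trans; [apply Cmod_ge_0|apply (HM (RtoC 0))]. rewrite Cmod_0. lra. }
  assert (Hc0 : c O = RtoC 0).
  { rewrite <- Hh0. apply (Cseries_unique (pterm c (RtoC 0))); [apply Cseries_pterm_0|].
    apply Sc. rewrite Cmod_0. lra. }
  pose (d := fun n => match n with O => RtoC 0 | S _ => (c n / RtoC (INR n))%C end).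
  assert (Hd : forall r n, 0 < r < R0 -> Cmod (d n) <= 2 * M / r ^ n).
  { intros r n Hr. eapply Rle_trans; [|now apply Hc].
    destruct n as [|n].
    - simpl d. rewrite Cmod_0. apply Cmod_ge_0.
    - unfold d. assert (Hn : 1 <= INR (S n)) by (rewrite S_INR; pose proof (pos_INR n); lra).
      rewrite Cmod_div by (intros E; apply RtoC_inj in E; lra).
      rewrite Cmod_R, Rabs_pos_eq by lra.
      apply (Rmult_le_reg_r (INR (S n))); [lra|].
      replace (Cmod (c (S n)) / INR (S n) * INR (S n)) with (Cmod (c (S n))) by (field; lra).
      pose proof (Cmod_ge_0 (c (S n))). nra. }
  (* Outside the disc the value zero is a dummy that makes [H] total. *)
  assert (Hex : forall z, exists l, Cmod z < R0 -> Cseries (pterm d z) l).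
  { intros z. destruct (Rlt_le_dec (Cmod z) R0) as [Hz|Hz].
    - pose proof (Cmod_ge_0 z).
      assert (Hr : 0 < (Cmod z + R0) / 2 < R0) by lra.
      destruct (geometric_Cseries (pterm d z) (2 * M) (Cmod z / ((Cmod z + R0) / 2)))
        as [l Hl].
      + apply div_lt_1; lra.
      + apply pterm_bound; [lra|]. intros n. now apply Hd.
      + now exists l.
    - exists (RtoC 0). intros H. lra. }
  pose (H := fun z => proj1_sig (constructive_indefinite_description _ (Hex z))).
  assert (HH : forall z, Cmod z < R0 -> Cseries (pterm d z) (H z)).
  { intros z. exact (proj2_sig (constructive_indefinite_description _ (Hex z))). }
  exists H. split.
  - apply (Cseries_unique (pterm d (RtoC 0))).
    + apply HH. rewrite Cmod_0. lra.
    + change (RtoC 0) with (d O). apply Cseries_pterm_0.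
  - intros z Hz. pose proof (Cmod_ge_0 z).
    assert (Hr : 0 < (Cmod z + R0) / 2 < R0) by lra.
    destruct (power_series_has_deriv d H (2 * M) ((Cmod z + R0) / 2) z) as [e [He Se]].
    + lra.
    + intros n. now apply Hd.
    + intros w Hw. apply HH. lra.
    + exists e. split; [exact He|].
      apply (Cseries_unique (pterm c z)); [|now apply Sc].
      apply (Cseries_ext (fun n => z * (d n * (RtoC (INR n) * z ^ pred n)))%C);
        [|now apply Cseries_scal].
      intros [|n]; unfold pterm, d.
      * rewrite Hc0. ring.
      * simpl pred. rewrite Cpow_S. field.
        intros E. apply RtoC_inj in E. pose proof (pos_INR n). rewrite S_INR in E. lra.
Qed.

(** A large disc of holomorphy forces a small increment between 0 and 1. Applied on the complex line
    through two points, it becomes a Lipschitz bound obtained without partial derivatives. *)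
Lemma cauchy_increment_bound (g : C -> C) (R0 M : R) : 2 <= R0 ->
  (forall z, Cmod z < R0 -> exists c, has_deriv g z c) ->
  (forall z, Cmod z < R0 -> Cmod (g z) <= M) ->
  Cmod (g (RtoC 1) - g (RtoC 0))%C <= 8 * M / R0.
Proof.
  intros HR Hg HM.
  destruct (holomorphic_power_series g R0 M ltac:(lra) Hg HM) as [c [Hc Sc]].
  assert (H0 : g (RtoC 0) = c O).
  { apply (Cseries_unique (pterm c (RtoC 0))); [|apply Cseries_pterm_0].
    apply Sc. rewrite Cmod_0. lra. }
  assert (HM0 : 0 <= M).
  { eapply Rle_trans; [apply Cmod_ge_0|apply (HM (RtoC 0))]. rewrite Cmod_0. lra. }
  (* Since [R0 >= 2], [1 / r <= 2 / 3] and the geometric factor is at most 3; then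
     [2 M * (4 / (3 R0)) * 3 = 8 M / R0]. *)
  set (r := 3 / 4 * R0).
  pose proof (pterm_bound c (RtoC 1) (2 * M) r ltac:(unfold r; lra)
    (fun n => Hc r n ltac:(unfold r; lra))) as Hb. rewrite Cmod_1 in Hb.
  pose proof (div_lt_1 1 r ltac:(lra) ltac:(unfold r; lra)) as Hq.
  pose proof (geometric_Cseries_tail _ _ _ _ 1 Hq Hb (Sc (RtoC 1) ltac:(rewrite Cmod_1; lra)))
    as T.
  simpl Csum in T. unfold pterm at 1 in T.
  replace (g 1 - (0 + c O * 1 ^ 0))%C with (g 1 - g 0)%C in T by (rewrite H0; simpl; ring).
  eapply Rle_trans; [exact T|]. simpl.
  replace (8 * M / R0) with (2 * M * (1 / r * 1) * 3) by (unfold r; field; lra).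
  unfold Rdiv at 1. apply Rmult_le_compat_l.
  - apply Rmult_le_pos; lra.
  - replace 3 with (/ (1 / 3)) by lra. apply Rinv_le_contravar; [lra|].
    assert (1 / r <= 2 / 3); [|lra].
    apply (Rmult_le_reg_r r); [unfold r; lra|].
    replace (1 / r * r) with 1 by (field; unfold r; lra). unfold r. lra.
Qed.

(** * Growth estimates along real rays *)

Definition has_deriv_R (phi : R -> C) (t : R) (d : C) : Prop :=
  is_derive (fun s => Re (phi s)) t (Re d) /\ is_derive (fun s => Im (phi s)) t (Im d).

Lemma has_deriv_R_minus (f g : R -> C) (t : R) (c d : C) :
  has_deriv_R f t c -> has_deriv_R g t d -> has_deriv_R (fun s => f s - g s)%C t (c - d)%C.
Proof.
  intros [H1 H2] [H3 H4]. split.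
  - apply (is_derive_minus (fun s => Re (f s)) (fun s => Re (g s))); trivial.
  - apply (is_derive_minus (fun s => Im (f s)) (fun s => Im (g s))); trivial.
Qed.

(** On the ray [s z] the operator [z d/dz] becomes [s d/ds], so iterates at complex points and the
    real solution obey one and the same real-variable estimate. *)
Lemma has_deriv_along_ray (h : C -> C) (z c : C) (s : R) :
  has_deriv h (RtoC s * z)%C c -> has_deriv_R (fun s => h (RtoC s * z)%C) s (z * c)%C.
Proof.
  intros Hh. pose proof (Cmod_ge_0 z) as Hz.
  assert (K : forall eps, 0 < eps -> exists d : posreal, forall k, k <> 0 -> Rabs k < d ->
    Cmod (h (RtoC (s + k) * z) - h (RtoC s * z) - RtoC k * (z * c))%C / Rabs k < eps).
  { intros eps He.
    destruct (Hh (eps / (2 * (Cmod z + 1)))) as [d [Hd K]].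
    { apply Rdiv_lt_0_compat; lra. }
    assert (Hd' : 0 < d / (Cmod z + 1)) by (apply Rdiv_lt_0_compat; lra).
    exists (mkposreal _ Hd'). simpl. intros k Hk Hkd.
    assert (Hk0 : 0 < Rabs k) by now apply Rabs_pos_lt.
    apply (Rmult_lt_compat_r (Cmod z + 1)) in Hkd; [|lra].
    replace (d / (Cmod z + 1) * (Cmod z + 1)) with d in Hkd by (field; lra).
    specialize (K (RtoC k * z)%C). rewrite Cmod_mult, Cmod_R in K. specialize (K ltac:(nra)).
    replace (h (RtoC (s + k) * z) - h (RtoC s * z) - RtoC k * (z * c))%C
      with (h (RtoC s * z + RtoC k * z) - h (RtoC s * z) - c * (RtoC k * z))%C
      by (rewrite RtoC_plus, Cmult_plus_distr_r; ring).
    apply (Rmult_lt_reg_r (Rabs k)); trivial.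
    unfold Rdiv at 1. rewrite Rmult_assoc, Rinv_l, Rmult_1_r by lra.
    eapply Rle_lt_trans; [exact K|].
    replace (eps / (2 * (Cmod z + 1)) * (Rabs k * Cmod z))
      with (eps * Rabs k * (Cmod z / (2 * (Cmod z + 1)))) by (field; lra).
    assert (HeK : 0 < eps * Rabs k) by (apply Rmult_lt_0_compat; lra).
    assert (Cmod z / (2 * (Cmod z + 1)) < 1).
    { apply (Rmult_lt_reg_r (2 * (Cmod z + 1))); [lra|].
      unfold Rdiv. rewrite Rmult_assoc, Rinv_l by lra. lra. }
    nra. }
  split; apply is_derive_Reals; intros eps He; destruct (K eps He) as [d Hd];
    exists d; intros k Hk Hkd; (eapply Rle_lt_trans; [|exact (Hd k Hk Hkd)]).
  - replace ((Re (h (RtoC (s + k) * z)%C) - Re (h (RtoC s * z)%C)) / k - Re (z * c)%C)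
      with (Re (h (RtoC (s + k) * z) - h (RtoC s * z) - RtoC k * (z * c))%C / k)
      by (unfold Re; simpl; now field).
    unfold Rdiv. rewrite Rabs_mult, Rabs_inv. apply Rmult_le_compat_r.
    + apply Rlt_le, Rinv_0_lt_compat. now apply Rabs_pos_lt.
    + apply re_le_Cmod.
  - replace ((Im (h (RtoC (s + k) * z)%C) - Im (h (RtoC s * z)%C)) / k - Im (z * c)%C)
      with (Im (h (RtoC (s + k) * z) - h (RtoC s * z) - RtoC k * (z * c))%C / k)
      by (unfold Im; simpl; now field).
    unfold Rdiv. rewrite Rabs_mult, Rabs_inv. apply Rmult_le_compat_r.
    + apply Rlt_le, Rinv_0_lt_compat. now apply Rabs_pos_lt.
    + apply im_le_Cmod.
Qed.

(* Mean value theorem for [Re (conj u * phi) - |u| B s^m / m] with [u = phi 1]. *)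
Lemma euler_estimate (phi dphi : R -> C) (B : R) (m : nat) : (1 <= m)%nat ->
  phi 0 = RtoC 0 -> (forall s, 0 <= s <= 1 -> has_deriv_R phi s (dphi s)) ->
  (forall s, 0 <= s <= 1 -> Cmod (RtoC s * dphi s)%C <= B * s ^ m) ->
  Cmod (phi 1) <= B / INR m.
Proof.
  intros Hm H0 Hd HB.
  assert (Hm0 : 0 < INR m) by (apply lt_0_INR; lia).
  assert (HB0 : 0 <= B).
  { specialize (HB 1 ltac:(lra)). rewrite pow1, Rmult_1_r in HB.
    eapply Rle_trans; [apply Cmod_ge_0|exact HB]. }
  set (u := phi 1). pose proof (Cmod_ge_0 u) as Hu.
  pose (g := fun s => Re u * Re (phi s) + Im u * Im (phi s) - Cmod u * (B / INR m) * s ^ m).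
  pose (g' := fun s => Re u * Re (dphi s) + Im u * Im (dphi s) - Cmod u * B * s ^ pred m).
  destruct (MVT_cor2 g g' 0 1 Rlt_0_1) as [c [Hc1 Hc2]].
  { intros s Hs. apply is_derive_Reals. destruct (Hd s Hs) as [D1 D2].
    unfold g, g'.
    apply (is_derive_minus (fun s => Re u * Re (phi s) + Im u * Im (phi s))
      (fun s => Cmod u * (B / INR m) * s ^ m)).
    - apply (is_derive_plus (fun s => Re u * Re (phi s)) (fun s => Im u * Im (phi s))).
      + now apply (is_derive_scal (fun s => Re (phi s))).
      + now apply (is_derive_scal (fun s => Im (phi s))).
    - replace (Cmod u * B * s ^ pred m)
        with (Cmod u * (B / INR m) * (INR m * 1 * s ^ pred m)) by (field; lra).
      apply is_derive_scal. apply (is_derive_pow (fun s => s)). auto_derive; trivial. }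
  assert (Hg1 : g 1 = Cmod u * Cmod u - Cmod u * (B / INR m)).
  { unfold g. fold u. rewrite pow1. pose proof (Cmod2_alt u). simpl in *. lra. }
  assert (Hg0 : g 0 = 0).
  { unfold g. rewrite H0, pow_i by lia. simpl. ring. }
  assert (Hgc : g' c <= 0).
  { unfold g'.
    assert (HR : Re u * Re (dphi c) + Im u * Im (dphi c) <= Cmod u * Cmod (dphi c)).
    { rewrite <- (Cmod_conj u), <- Cmod_mult.
      eapply Rle_trans; [|apply re_le_Cmod]. eapply Rle_trans; [|apply Rle_abs].
      apply Req_le. unfold Re, Im. simpl. ring. }
    (* The mean value point satisfies [c > 0], so the bound on [c * dphi c] may be divided by
       [c]. *)
    specialize (HB c ltac:(lra)). rewrite Cmod_RtoC_mult in HB by lra.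
    destruct m as [|k]; [lia|]. simpl pred. simpl pow in HB.
    assert (Cmod (dphi c) <= B * c ^ k) by (apply (Rmult_le_reg_l c); lra).
    assert (Cmod u * Cmod (dphi c) <= Cmod u * (B * c ^ k)) by (apply Rmult_le_compat_l; lra).
    lra. }
  rewrite Hg1, Hg0 in Hc1.
  assert (0 <= B / INR m) by (apply Rdiv_le_0_compat; lra).
  apply Rnot_lt_le. intros Hlt. nra.
Qed.

(** * Polynomial approximation of smooth functions *)

Fixpoint Rpoly (p : nat -> R) (m : nat) (t : R) : R :=
  match m with O => 0 | S k => Rpoly p k t + p k * t ^ k end.

Lemma is_derive_Rpoly_primitive (p : nat -> R) (a : R) (m : nat) (t : R) :
  is_derive (Rpoly (fun n => match n with O => a | S k => p k / INR (S k) end) (S m)) t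
    (Rpoly p m t).
Proof.
  set (p' := fun n => match n with O => a | S k => p k / INR (S k) end).
  induction m as [|m IH].
  - simpl. auto_derive; trivial.
  - change (Rpoly p' (S (S m))) with (fun t => Rpoly p' (S m) t + p' (S m) * t ^ S m).
    simpl (Rpoly p (S m) t).
    apply (is_derive_plus (Rpoly p' (S m)) (fun t => p' (S m) * t ^ S m)); trivial.
    replace (p m * t ^ m) with (p' (S m) * (INR (S m) * 1 * t ^ pred (S m))).
    + apply is_derive_scal. apply (is_derive_pow (fun t => t)). auto_derive; trivial.
    + unfold p'. simpl pred. field. rewrite S_INR. pose proof (pos_INR m). lra.
Qed.

Lemma Rpoly_0 (p : nat -> R) (m : nat) : Rpoly p (S m) 0 = p O.
Proof.
  induction m as [|m IH]; [simpl; ring|].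
  change (Rpoly p (S m) 0 + p (S m) * 0 ^ S m = p O). rewrite IH. simpl. ring.
Qed.

(** Taylor's formula by induction on [m]: approximate [Derive g], integrate the polynomial, and gain
    one factor [|t|] from the mean value theorem. The function [g] is quantified after [m] so that
    the induction hypothesis applies to its derivative; compactness of [|t| <= r / 2] gives the case
    [m = 0]. *)
Lemma smooth_polynomial_approximation (r : R) (m : nat) : 0 < r ->
  forall g : R -> R, (forall n t, Rabs t < r -> ex_derive_n g n t) ->
  exists (p : nat -> R) (K : R), 0 <= K /\ forall t, Rabs t <= r / 2 ->
    Rabs (g t - Rpoly p m t) <= K * Rabs t ^ m.
Proof.
  intros Hr. induction m as [|m IH]; intros g Hg.
  - assert (Hc : forall t, - (r / 2) <= t <= r / 2 -> continuity_pt g t).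
    { intros t Ht. apply continuity_pt_filterlim, (ex_derive_continuous g).
      apply (Hg 1%nat). apply Rabs_lt_between. lra. }
    destruct (continuity_ab_maj g (- (r / 2)) (r / 2) ltac:(lra) Hc) as [x1 [H1 _]].
    destruct (continuity_ab_min g (- (r / 2)) (r / 2) ltac:(lra) Hc) as [x2 [H2 _]].
    exists (fun _ => 0), (Rabs (g x1) + Rabs (g x2)).
    pose proof (Rabs_pos (g x1)). pose proof (Rabs_pos (g x2)).
    split; [lra|]. intros t Ht.
    apply Rabs_le_between in Ht. simpl. rewrite Rmult_1_r, Rminus_0_r.
    specialize (H1 t Ht). specialize (H2 t Ht).
    pose proof (Rle_abs (g x1)). pose proof (Rle_abs (- g x2)). rewrite Rabs_Ropp in *.
    apply Rabs_le. lra.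
  - destruct (IH (Derive g)) as [p [K [HK0 HK]]].
    { intros n t Ht. destruct n as [|n]; [exact I|]. simpl.
      apply (ex_derive_ext (Derive_n g (S n))).
      - intros s. rewrite <- Nat.add_1_r. symmetry. apply (Derive_n_comp g n 1).
      - apply (Hg (S (S n)) t Ht). }
    exists (fun n => match n with O => g 0 | S k => p k / INR (S k) end), K.
    split; trivial. intros t Ht.
    set (q := fun n => match n with O => g 0 | S k => p k / INR (S k) end).
    pose (d := fun s => g s - Rpoly q (S m) s).
    assert (Hd : forall s, Rabs s <= r / 2 -> is_derive d s (Derive g s - Rpoly p m s)).
    { intros s Hs. apply (is_derive_minus g (Rpoly q (S m))).
      - apply Derive_correct. apply (Hg 1%nat). lra.
      - apply is_derive_Rpoly_primitive. }
    assert (Hin : forall s, Rmin 0 t <= s <= Rmax 0 t -> Rabs s <= Rabs t).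
    { intros s. unfold Rmin, Rmax. destruct (Rle_dec 0 t) as [h|h]; intros Hs.
      - rewrite !Rabs_pos_eq; lra.
      - rewrite !Rabs_left1; lra. }
    destruct (MVT_gen d 0 t (fun s => Derive g s - Rpoly p m s)) as [c [Hc1 Hc2]].
    { intros s Hs. apply Hd. specialize (Hin s ltac:(lra)). lra. }
    { intros s Hs. apply continuity_pt_filterlim, (ex_derive_continuous d).
      eexists. apply Hd. specialize (Hin s ltac:(lra)). lra. }
    specialize (Hin c Hc1).
    assert (Hd0 : d 0 = 0) by (unfold d; rewrite Rpoly_0; unfold q; ring).
    change (Rabs (d t) <= K * Rabs t ^ S m).
    replace (d t) with (d t - d 0) by (rewrite Hd0; ring).
    rewrite Hc2, Rminus_0_r, Rabs_mult. specialize (HK c ltac:(lra)).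
    apply Rle_trans with (K * Rabs t ^ m * Rabs t); [|simpl; lra].
    apply Rmult_le_compat_r; [apply Rabs_pos|]. eapply Rle_trans; [exact HK|].
    apply Rmult_le_compat_l; trivial. apply pow_incr. split; [apply Rabs_pos|trivial].
Qed.

Lemma Csum_pterm_real (p q : nat -> R) (m : nat) (t : R) :
  Csum (pterm (fun n => (p n, q n)) (RtoC t)) m = (Rpoly p m t, Rpoly q m t).
Proof.
  induction m as [|m IH]; simpl; [trivial|].
  rewrite IH. unfold pterm. rewrite <- RtoC_pow.
  apply injective_projections; simpl; ring.
Qed.

Lemma smooth_on_polynomial_approximation (r : R) (y : R -> C) (m : nat) :
  0 < r -> smooth_on r y -> exists (c : nat -> C) (K : R), 0 <= K /\
    forall t, Rabs t <= r / 2 -> Cmod (y t - Csum (pterm c (RtoC t)) m)%C <= K * Rabs t ^ m.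
Proof.
  intros Hr Hy.
  destruct (smooth_polynomial_approximation r m Hr (fun s => Re (y s))) as [p [K1 [HK1 H1]]].
  { intros n t Ht. apply (Hy n t Ht). }
  destruct (smooth_polynomial_approximation r m Hr (fun s => Im (y s))) as [q [K2 [HK2 H2]]].
  { intros n t Ht. apply (Hy n t Ht). }
  exists (fun n => (p n, q n)), (K1 + K2). split; [lra|]. intros t Ht.
  rewrite Csum_pterm_real. eapply Rle_trans; [apply Cmod_le_Re_Im|].
  specialize (H1 t Ht). specialize (H2 t Ht).
  rewrite Rmult_plus_distr_r. apply Rplus_le_compat; trivial.
Qed.

(** * Rules of complex differentiation, and analyticity of power series *)

Lemma has_deriv_plus (g h : C -> C) (z c d : C) :
  has_deriv g z c -> has_deriv h z d -> has_deriv (fun z => g z + h z)%C z (c + d)%C.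
Proof.
  intros Hg Hh eps He.
  destruct (Hg (eps / 2) ltac:(lra)) as [d1 [Hd1 K1]].
  destruct (Hh (eps / 2) ltac:(lra)) as [d2 [Hd2 K2]].
  exists (Rmin d1 d2). split; [now apply Rmin_pos|]. intros w Hw.
  specialize (K1 w (Rlt_le_trans _ _ _ Hw (Rmin_l _ _))).
  specialize (K2 w (Rlt_le_trans _ _ _ Hw (Rmin_r _ _))).
  replace (g (z + w) + h (z + w) - (g z + h z) - (c + d) * w)%C
    with ((g (z + w) - g z - c * w) + (h (z + w) - h z - d * w))%C by ring.
  eapply Rle_trans; [apply Cmod_triangle|]. lra.
Qed.

Lemma has_deriv_scal (a : C) (h : C -> C) (z d : C) :
  has_deriv h z d -> has_deriv (fun z => a * h z)%C z (a * d)%C.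
Proof.
  intros Hh eps He. pose proof (Cmod_ge_0 a).
  destruct (Hh (eps / (Cmod a + 1))) as [d1 [Hd1 K1]]; [apply Rdiv_lt_0_compat; lra|].
  exists d1. split; trivial. intros w Hw. specialize (K1 w Hw). pose proof (Cmod_ge_0 w).
  replace (a * h (z + w) - a * h z - a * d * w)%C
    with (a * (h (z + w) - h z - d * w))%C by ring.
  rewrite Cmod_mult.
  apply (Rmult_le_compat_r (Cmod a + 1)) in K1; [|lra].
  replace (eps / (Cmod a + 1) * Cmod w * (Cmod a + 1)) with (eps * Cmod w) in K1
    by (field; lra).
  pose proof (Cmod_ge_0 (h (z + w) - h z - d * w)%C). nra.
Qed.

Lemma has_deriv_affine (a b z : C) : has_deriv (fun z => a + b * z)%C z b.
Proof.
  intros eps He. exists 1. split; [lra|]. intros w _.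
  replace (a + b * (z + w) - (a + b * z) - b * w)%C with (RtoC 0) by ring.
  rewrite Cmod_0. pose proof (Cmod_ge_0 w). nra.
Qed.

Lemma has_deriv_minus (g h : C -> C) (z c d : C) :
  has_deriv g z c -> has_deriv h z d -> has_deriv (fun z => g z - h z)%C z (c - d)%C.
Proof.
  intros Hg Hh eps He.
  destruct (has_deriv_plus g _ z c _ Hg (has_deriv_scal (RtoC (-1)) h z d Hh) eps He)
    as [d1 [Hd1 K1]].
  exists d1. split; trivial. intros w Hw. specialize (K1 w Hw).
  match type of K1 with Cmod ?X <= _ => match goal with |- Cmod ?Y <= _ =>
    replace Y with X by ring end end. exact K1.
Qed.

Lemma has_deriv_shift (h : C -> C) (a z c : C) :
  has_deriv h (a + z)%C c -> has_deriv (fun z => h (a + z)%C) z c.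
Proof.
  intros Hh eps He. destruct (Hh eps He) as [d [Hd K]]. exists d. split; trivial.
  intros w Hw. rewrite Cplus_assoc. auto.
Qed.

Lemma has_deriv_polynomial (c : nat -> C) (m : nat) (z : C) :
  exists d, has_deriv (fun z => Csum (pterm c z) m) z d.
Proof.
  induction m as [|m [d IH]]; simpl.
  - exists (RtoC 0). intros eps He. exists 1. split; [lra|]. intros w _.
    replace (0 - 0 - 0 * w)%C with (RtoC 0) by ring.
    rewrite Cmod_0. pose proof (Cmod_ge_0 w). nra.
  - exists (d + c m * (RtoC (INR m) * z ^ pred m))%C.
    apply (has_deriv_plus (fun z => Csum (pterm c z) m)); [exact IH|].
    apply has_deriv_scal.
    apply (has_deriv_of_quadratic_bound _ _ _ ((Cmod z + 1) ^ m) 1 Rlt_0_1). intros w Hw.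
    pose proof (pow_increment_bound z w 1 m Rlt_0_1 (Rlt_le _ _ Hw)) as H.
    unfold pow_increment in H. lra.
Qed.

(** The series is recentred at [t0] without rearranging a double sum: its sum [Y] is holomorphic and
    bounded on a disc around [t0], hence has a power series there. *)
Lemma real_analytic_of_power_series (c : nat -> C) (y : R -> C) (M r : R) : 0 < r ->
  (forall n, Cmod (c n) <= M / r ^ n) ->
  (forall t, Rabs t < r -> Cseries (pterm c (RtoC t)) (y t)) ->
  real_analytic_near_0 y.
Proof.
  intros Hr Hc Hy. exists r. split; trivial. intros t0 Ht0. pose proof (Rabs_pos t0) as Ht0'.
  assert (HM : 0 <= M).
  { pose proof (Hc O) as H0. pose proof (Cmod_ge_0 (c O)). simpl in H0. lra. }
  assert (Hex : forall z, exists l, Cmod z < r -> Cseries (pterm c z) l).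
  { intros z. destruct (Rlt_le_dec (Cmod z) r) as [Hz|Hz].
    - destruct (geometric_Cseries (pterm c z) M (Cmod z / r)) as [l Hl].
      + apply div_lt_1; trivial. apply Cmod_ge_0.
      + now apply pterm_bound.
      + now exists l.
    - exists (RtoC 0). intros H. lra. }
  pose (Y := fun z => proj1_sig (constructive_indefinite_description _ (Hex z))).
  assert (HY : forall z, Cmod z < r -> Cseries (pterm c z) (Y z)).
  { intros z. exact (proj2_sig (constructive_indefinite_description _ (Hex z))). }
  (* The disc of radius [d] around [t0] stays within radius [(r + |t0|) / 2] of the origin, where
     the series is dominated by powers of [q]. *)
  set (d := (r - Rabs t0) / 2). set (q := (r + Rabs t0) / 2 / r).
  assert (Hq : 0 <= q < 1) by (apply div_lt_1; lra).
  assert (Hin : forall z, Cmod z < d -> Cmod (RtoC t0 + z)%C < (r + Rabs t0) / 2).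
  { intros z Hz. eapply Rle_lt_trans; [apply Cmod_triangle|]. rewrite Cmod_R.
    unfold d in Hz. lra. }
  destruct (holomorphic_power_series (fun z => Y (RtoC t0 + z)%C) d (M / (1 - q)))
    as [a [_ Sa]].
  - unfold d. lra.
  - intros z Hz. specialize (Hin z Hz).
    destruct (power_series_has_deriv c Y M r (RtoC t0 + z)%C) as [e [He _]]; trivial; [lra|].
    exists e. now apply has_deriv_shift.
  - intros z Hz. specialize (Hin z Hz). pose proof (Cmod_ge_0 (RtoC t0 + z)%C).
    assert (Hb : forall n, Cmod (pterm c (RtoC t0 + z)%C n) <= M * q ^ n).
    { intros n. eapply Rle_trans; [apply (pterm_bound c _ M r Hr Hc)|].
      apply Rmult_le_compat_l; trivial. apply pow_incr. split.
      - apply Rdiv_le_0_compat; lra.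
      - apply Rmult_le_compat_r; [apply Rlt_le, Rinv_0_lt_compat; lra|lra]. }
    pose proof (geometric_Cseries_tail _ _ _ _ O Hq Hb (HY (RtoC t0 + z)%C ltac:(lra))) as T.
    simpl in T. replace (Y (t0 + z) - 0)%C with (Y (t0 + z)%C) in T by ring.
    now rewrite Rmult_1_r in T.
  - exists d, a. split; [unfold d; lra|]. intros t Ht.
    assert (Hz : Cmod (RtoC (t - t0)) < d) by now rewrite Cmod_R.
    specialize (Sa _ Hz). cbv beta in Sa. specialize (Hin _ Hz).
    replace (RtoC t0 + RtoC (t - t0))%C with (RtoC t) in * by (rewrite RtoC_minus; ring).
    rewrite Cmod_R in Hin.
    rewrite (Cseries_unique _ _ _ (Hy t ltac:(lra)) (HY (RtoC t) ltac:(rewrite Cmod_R; lra))).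
    apply (filterlim_locally (F := eventually) _ (Y (RtoC t))). intros eps.
    destruct (Sa eps (cond_pos eps)) as [n0 H0]. exists n0. intros n Hn.
    apply (norm_compat1 (V := C_NormedModule)).
    (* The partial sums in [is_series] include the index [n], hence the shift to [S n]. *)
    specialize (H0 (S n) ltac:(lia)).
    match goal with |- norm (minus ?X _) < _ =>
      replace X with (Csum (pterm a (RtoC (t - t0))) (S n)); [exact H0|] end.
    clear. induction n as [|n IH].
    + rewrite sum_O. unfold pterm. simpl. ring.
    + rewrite sum_Sn, <- IH. unfold pterm at 2. rewrite RtoC_pow. reflexivity.
Qed.

(** * Analyticity of geometric limits *)

Lemma pointwise_choice (A B : Type) (Q : A -> B -> Prop) :
  (forall a, exists b, Q a b) -> exists g : A -> B, forall a, Q a (g a).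
Proof.
  intros H. exists (fun a => proj1_sig (constructive_indefinite_description _ (H a))).
  intros a. exact (proj2_sig (constructive_indefinite_description _ (H a))).
Qed.

(** Instead of showing that a uniform limit is holomorphic, the coefficients of the increments
    [U (S k) - U k] are summed: Cauchy's estimates make them geometric in [k]. Closeness to [y] is
    asked only at real points. *)
Lemma real_analytic_of_geometric_limit (y : R -> C) (U : nat -> C -> C) (delta A : R) :
  0 < delta ->
  (forall k z, Cmod z < delta -> exists c, has_deriv (U k) z c) ->
  (forall z, Cmod z < delta -> Cmod (U O z) <= A) ->
  (forall k z, Cmod z < delta -> Cmod (U (S k) z - U k z)%C <= A * (/ 2) ^ k) ->
  (forall k t, Rabs t < delta -> Cmod (y t - U k (RtoC t))%C <= A * (/ 2) ^ k) ->
  real_analytic_near_0 y.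
Proof.
  intros Hd HU HA HS Hy. set (r := delta / 2).
  assert (Hr : 0 < r < delta) by (unfold r; lra).
  assert (HA0 : 0 <= A).
  { eapply Rle_trans; [apply Cmod_ge_0|apply (HA (RtoC 0))]. rewrite Cmod_0. lra. }
  destruct (holomorphic_power_series (U O) delta A Hd (HU O) HA) as [c0 [Hc0 Sc0]].
  assert (Hex : forall k, exists d : nat -> C,
    (forall n, Cmod (d n) <= 2 * (A * (/ 2) ^ k) / r ^ n) /\
    forall z, Cmod z < delta -> Cseries (pterm d z) (U (S k) z - U k z)%C).
  { intros k.
    destruct (holomorphic_power_series (fun z => U (S k) z - U k z)%C delta (A * (/ 2) ^ k))
      as [d [H1 H2]]; trivial.
    - intros z Hz. destruct (HU (S k) z Hz) as [c1 K1]. destruct (HU k z Hz) as [c2 K2].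
      exists (c1 - c2)%C. now apply has_deriv_minus.
    - auto.
    - exists d. auto. }
  destruct (pointwise_choice _ _ _ Hex) as [d Hdk]. clear Hex.
  pose (ck := fun k n => (c0 n + Csum (fun i => d i n) k)%C).
  assert (Sck : forall k z, Cmod z < delta -> Cseries (pterm (ck k) z) (U k z)).
  { intros k z Hz. induction k as [|k IH].
    - apply (Cseries_ext (pterm c0 z)); [|auto]. intros n. unfold pterm, ck. simpl. ring.
    - apply (Cseries_ext (fun n => pterm (ck k) z n + pterm (d k) z n)%C).
      + intros n. unfold pterm, ck. simpl. ring.
      + replace (U (S k) z) with (U k z + (U (S k) z - U k z))%C by ring.
        apply Cseries_plus; trivial. now apply (Hdk k). }
  assert (Hq : 0 <= / 2 < 1) by lra.
  assert (Hb : forall n i, Cmod (d i n) <= (2 * A / r ^ n) * (/ 2) ^ i).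
  { intros n i. destruct (Hdk i) as [Hi _]. eapply Rle_trans; [apply Hi|].
    apply Req_le. unfold Rdiv. ring. }
  destruct (pointwise_choice _ _ (fun n l => Cseries (fun i => d i n) l)) as [s Hs].
  { intros n. exact (geometric_Cseries _ _ _ Hq (Hb n)). }
  pose (e := fun n => (c0 n + s n)%C).
  assert (He : forall k n, Cmod (e n - ck k n)%C <= 4 * A * (/ 2) ^ k / r ^ n).
  { intros k n. unfold e, ck.
    replace (c0 n + s n - (c0 n + Csum (fun i => d i n) k))%C
      with (s n - Csum (fun i => d i n) k)%C by ring.
    eapply Rle_trans; [exact (geometric_Cseries_tail _ _ _ _ k Hq (Hb n) (Hs n))|].
    apply Req_le. replace (1 - / 2) with (/ 2) by lra. unfold Rdiv. rewrite Rinv_inv. ring. }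
  (* [6 A = 2 A + 4 A]: the Cauchy bound for [U 0] and the sum of all later corrections. *)
  apply (real_analytic_of_power_series e y (6 * A) r); [lra| |].
  - intros n. specialize (He O n). unfold ck in He. simpl in He.
    replace (e n) with ((e n - (c0 n + 0)) + c0 n)%C by ring.
    eapply Rle_trans; [apply Cmod_triangle|]. specialize (Hc0 r n Hr). unfold Rdiv in *. lra.
  - intros t Ht.
    assert (Hmt : Cmod (RtoC t) < r) by now rewrite Cmod_R.
    pose proof (div_lt_1 _ _ (Cmod_ge_0 (RtoC t)) Hmt) as Hqt.
    set (q := Cmod (RtoC t) / r) in *.
    (* For each [k] the limit series sums to [U k] plus an error that tends to zero with [k]. By
       uniqueness the sum does not depend on [k], so it equals the limit [y t]. *)
    assert (HL : forall k, exists l, Cseries (pterm e (RtoC t)) (l + U k (RtoC t))%C /\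
      Cmod l <= 4 * A * (/ 2) ^ k / (1 - q)).
    { intros k.
      pose proof (pterm_bound (fun n => e n - ck k n)%C (RtoC t) _ r (proj1 Hr) (He k)) as Hbk.
      fold q in Hbk.
      destruct (geometric_Cseries _ _ q Hqt Hbk) as [l Hl]. exists l. split.
      - apply (Cseries_ext (fun n => pterm (fun n => e n - ck k n) (RtoC t) n
                                      + pterm (ck k) (RtoC t) n)%C).
        + intros n. unfold pterm. ring.
        + apply Cseries_plus; trivial. apply Sck. lra.
      - pose proof (geometric_Cseries_tail _ _ _ _ O Hqt Hbk Hl) as T. simpl Csum in T.
        replace (l - 0)%C with l in T by ring. simpl in T. now rewrite Rmult_1_r in T. }
    destruct (HL O) as [l0 [HX _]]. set (X := (l0 + U O (RtoC t))%C) in *.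
    replace (y t) with X; trivial.
    apply eq_of_Cmod_minus_le. intros eps Heps.
    destruct (half_pow_small (4 * A / (1 - q) + A) eps Heps) as [k Hk].
    destruct (HL k) as [l [Hl1 Hl2]].
    rewrite (Cseries_unique _ _ _ HX Hl1).
    replace (l + U k t - y t)%C with (l - (y t - U k t))%C by ring.
    eapply Rle_trans; [apply Cmod_triangle_minus|].
    specialize (Hy k t ltac:(lra)). unfold Rdiv in *. lra.
Qed.

Lemma euler_estimate_exists (phi : R -> C) (B : R) (m : nat) : (1 <= m)%nat ->
  phi 0 = RtoC 0 ->
  (forall s, 0 <= s <= 1 -> exists d, has_deriv_R phi s d /\ Cmod (RtoC s * d)%C <= B * s ^ m) ->
  Cmod (phi 1) <= B / INR m.
Proof.
  intros Hm H0 H.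
  destruct (pointwise_choice _ _ (fun s d => 0 <= s <= 1 ->
    has_deriv_R phi s d /\ Cmod (RtoC s * d)%C <= B * s ^ m)) as [dphi Hd].
  { intros s. destruct (Rle_dec 0 s) as [h1|h1]; [destruct (Rle_dec s 1) as [h2|h2]|].
    - destruct (H s (conj h1 h2)) as [d Hd]. now exists d.
    - exists (RtoC 0). intros Hs. lra.
    - exists (RtoC 0). intros Hs. lra. }
  apply (euler_estimate phi dphi); trivial; intros s Hs; now apply Hd.
Qed.

(** Smallness on a positive real interval removes the coefficients below [m], and what is left is a
    tail starting with [z^m] on a complex disc. The 4 is the Cauchy factor 2 times the geometric
    factor 2 for [|z|] at most half of [eta / 2]. *)
Lemma power_series_vanishing_order (E : C -> C) (eta K : R) (m : nat) : 0 < eta ->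
  (forall z, Cmod z < eta -> exists c, has_deriv E z c) ->
  (forall z, Cmod z < eta -> Cmod (E z) <= 1) ->
  (forall t, 0 < t < eta -> Cmod (E (RtoC t)) <= K * t ^ m) ->
  forall z, Cmod z < eta / 4 -> Cmod (E z) <= 4 / (eta / 2) ^ m * Cmod z ^ m.
Proof.
  intros He HE H1 HK z Hz.
  destruct (holomorphic_power_series E eta 1 He HE H1) as [e [Hb He']].
  set (r := eta / 2). assert (Hr : 0 < r < eta) by (unfold r; lra).
  assert (Hb' : forall n, Cmod (e n) <= 2 / r ^ n).
  { intros n. specialize (Hb r n Hr). now rewrite Rmult_1_r in Hb. }
  assert (Z : forall n, (n < m)%nat -> e n = RtoC 0).
  { apply (power_series_order e (fun t => E (RtoC t)) 2 r eta K m); trivial; [lra|].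
    intros t Ht. apply He'. rewrite Cmod_R, Rabs_pos_eq; lra. }
  assert (Z' : forall k, (k <= m)%nat -> Csum (pterm e z) k = RtoC 0).
  { intros k. induction k as [|k IH]; intros Hk; simpl; trivial.
    rewrite IH by lia. unfold pterm. rewrite Z by lia. ring. }
  pose proof (Cmod_ge_0 z) as Hz0.
  assert (Hzr : Cmod z < r) by (unfold r; lra).
  pose proof (div_lt_1 _ _ Hz0 Hzr) as Hq.
  pose proof (geometric_Cseries_tail _ _ _ _ m Hq
    (pterm_bound e z 2 r (proj1 Hr) Hb') (He' z ltac:(lra))) as T.
  rewrite Z' in T by lia. replace (E z - 0)%C with (E z) in T by ring.
  eapply Rle_trans; [exact T|].
  replace (4 / r ^ m * Cmod z ^ m) with (2 * (Cmod z / r) ^ m * 2)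
    by (unfold Rdiv; rewrite Rpow_mult_distr, pow_inv; ring).
  unfold Rdiv at 1. apply Rmult_le_compat_l.
  - assert (0 <= (Cmod z / r) ^ m) by (apply pow_le; lra). lra.
  - replace 2 with (/ (1 / 2)) by lra. apply Rinv_le_contravar; [lra|].
    assert (Cmod z / r <= 1 / 2); [|lra]. apply (Rmult_le_reg_r r); [lra|].
    replace (Cmod z / r * r) with (Cmod z) by (field; lra). unfold r. lra.
Qed.

(** * The iteration *)

Lemma has_deriv_R_dilation (y : R -> C) (r s t : R) : smooth_on r y -> Rabs (s * t) < r ->
  has_deriv_R (fun s => y (s * t)) s (RtoC t * cderive y (s * t))%C.
Proof.
  intros Hy Hst. destruct (Hy 1%nat (s * t) Hst) as [H1 H2]. simpl in H1, H2.
  assert (Hm : is_derive (fun s => s * t) s t) by (auto_derive; trivial; ring).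
  split.
  - replace (Re (RtoC t * cderive y (s * t))%C) with (t * Derive (fun u => Re (y u)) (s * t))
      by (unfold cderive, Re; simpl; ring).
    apply (is_derive_comp (fun u => Re (y u)) (fun s => s * t)); trivial.
    now apply Derive_correct.
  - replace (Im (RtoC t * cderive y (s * t))%C) with (t * Derive (fun u => Im (y u)) (s * t))
      by (unfold cderive, Im; simpl; ring).
    apply (is_derive_comp (fun u => Im (y u)) (fun s => s * t)); trivial.
    now apply Derive_correct.
Qed.

Lemma pow_le_self (x : R) (m : nat) : (1 <= m)%nat -> 0 <= x <= 1 -> x ^ m <= x.
Proof.
  intros Hm Hx. destruct m as [|m]; [lia|]. simpl.
  assert (H : x ^ m <= 1 ^ m) by (apply pow_incr; lra). rewrite pow1 in H. nra.
Qed.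

(* Stands in for the finiteness of the index type. *)
Definition uniform_thresholds (I : Type) : Prop :=
  forall Q : I -> R -> Prop,
    (forall j, exists d, 0 < d /\ forall d', 0 < d' <= d -> Q j d') ->
    exists d, 0 < d /\ forall j, Q j d.

Section BriotBouquet.
Variables (I : Type) (f : I -> C -> (I -> C) -> C) (rho M : R).
Hypothesis Huni : uniform_thresholds I.
Hypothesis Hrho : 0 < rho.
Hypothesis HM : 0 <= M.
(** Holomorphy in the form in which it is used: along functions of one variable. These are the
    iterates in [solves_exists] and a complex line in [f_lipschitz]. *)
Hypothesis f_comp : forall j (z0 : C -> C) (w : I -> C -> C) (x : C),
  Cmod (z0 x) < rho -> (forall k, Cmod (w k x) < rho) ->
  (exists c, has_deriv z0 x c) -> (forall k, exists c, has_deriv (w k) x c) ->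
  exists c, has_deriv (fun x => f j (z0 x) (fun k => w k x)) x c.
Hypothesis f_bound : forall j z w,
  Cmod z < rho -> (forall k, Cmod (w k) < rho) -> Cmod (f j z w) <= M.
Hypothesis f_0 : forall j, f j (RtoC 0) (fun _ => RtoC 0) = RtoC 0.

(** On the complex line [w' + (w - w') x] the arguments stay below [rho / 2 + A |x| < rho] for
    [|x| < rho / (2 A)]; the increment bound on that disc gives [8 M / (rho / (2 A))]. *)
Lemma f_lipschitz (j : I) (z : C) (w w' : I -> C) (A : R) : Cmod z < rho ->
  (forall k, Cmod (w k) < rho / 2) -> (forall k, Cmod (w' k) < rho / 2) ->
  0 <= A -> (forall k, Cmod (w k - w' k)%C <= A) ->
  Cmod (f j z w - f j z w')%C <= 16 * M / rho * A.
Proof.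
  intros Hz Hw Hw' HA0 HA.
  destruct (Rle_lt_or_eq_dec _ _ HA0) as [HAp|<-].
  (* Below [rho / 4] the disc has radius at least 2, as the increment bound requires; above it the
     trivial bound [2 M] suffices. *)
  - destruct (Rlt_le_dec A (rho / 4)) as [HA4|HA4].
    + pose (g := fun x => f j z (fun k => w' k + (w k - w' k) * x)%C).
      assert (HR : 2 <= rho / (2 * A)).
      { apply (Rmult_le_reg_r (2 * A)); [lra|].
        replace (rho / (2 * A) * (2 * A)) with rho by (field; lra). lra. }
      assert (Hin : forall x, Cmod x < rho / (2 * A) ->
        forall k, Cmod (w' k + (w k - w' k) * x)%C < rho).
      { intros x Hx k. eapply Rle_lt_trans; [apply Cmod_triangle|]. rewrite Cmod_mult.
        apply (Rmult_lt_compat_r (2 * A)) in Hx; [|lra].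
        replace (rho / (2 * A) * (2 * A)) with rho in Hx by (field; lra).
        pose proof (Cmod_ge_0 x). specialize (HA k). specialize (Hw' k). nra. }
      pose proof (cauchy_increment_bound g (rho / (2 * A)) M HR) as HC.
      replace (f j z w) with (g (RtoC 1)).
      2:{ unfold g. f_equal. apply functional_extensionality. intros k. ring. }
      replace (f j z w') with (g (RtoC 0)).
      2:{ unfold g. f_equal. apply functional_extensionality. intros k. ring. }
      replace (16 * M / rho * A) with (8 * M / (rho / (2 * A))) by (field; lra).
      apply HC.
      * intros x Hx. apply (f_comp j (fun _ => z) (fun k x => w' k + (w k - w' k) * x)%C x).
        -- exact Hz.
        -- apply Hin, Hx.
        -- exists (RtoC 0). intros eps He. exists 1. split; [lra|]. intros u _.
           replace (z - z - 0 * u)%C with (RtoC 0) by ring. rewrite Cmod_0.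
           pose proof (Cmod_ge_0 u). nra.
        -- intros k. eexists. apply has_deriv_affine.
      * intros x Hx. apply f_bound; trivial. now apply Hin.
    + pose proof (Cmod_triangle_minus (f j z w) (f j z w')).
      assert (Cmod (f j z w) <= M) by (apply f_bound; trivial; intros k; specialize (Hw k); lra).
      assert (Cmod (f j z w') <= M)
        by (apply f_bound; trivial; intros k; specialize (Hw' k); lra).
      assert (0 <= M / rho) by (apply Rdiv_le_0_compat; lra).
      assert (4 * M <= 16 * M / rho * A); [|lra].
      replace (4 * M) with (16 * (M / rho) * (rho / 4)) by (field; lra).
      replace (16 * M / rho) with (16 * (M / rho)) by (unfold Rdiv; ring).
      apply Rmult_le_compat_l; lra.
  - replace w' with w.
    + replace (f j z w - f j z w)%C with (RtoC 0) by ring. rewrite Cmod_0. lra.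
    + apply functional_extensionality. intros k. apply eq_of_Cmod_minus_le.
      intros eps He. specialize (HA k). lra.
Qed.

(** One step of the iteration, as a relation; the value at zero fixes the constant of
    integration. *)
Definition solves (delta : R) (u v : I -> C -> C) : Prop :=
  forall j, v j (RtoC 0) = RtoC 0 /\ forall z, Cmod z < delta ->
    exists c, has_deriv (v j) z c /\ (z * c)%C = f j z (fun k => u k z).

(** The bound [rho / 2], rather than [rho], leaves room for the complex line used in
    [f_lipschitz]. *)
Definition admissible (delta : R) (u : I -> C -> C) : Prop :=
  (forall j z, Cmod z < delta -> exists c, has_deriv (u j) z c) /\
  (forall j, u j (RtoC 0) = RtoC 0) /\
  (forall j z, Cmod z < delta -> Cmod (u j z) < rho / 2).

Lemma solves_exists (delta : R) (u : I -> C -> C) : 0 < delta <= rho ->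
  admissible delta u -> exists v, solves delta u v.
Proof.
  intros Hd (H1 & H2 & H3).
  destruct (pointwise_choice I (C -> C) (fun j vj => vj (RtoC 0) = RtoC 0 /\
    forall z, Cmod z < delta ->
      exists c, has_deriv vj z c /\ (z * c)%C = f j z (fun k => u k z))) as [v Hv].
  - intros j. apply (euler_primitive (fun z => f j z (fun k => u k z)) delta M); [lra| | |].
    + intros z Hz. apply (f_comp j (fun z => z) u z); [lra| | |].
      * intros k. specialize (H3 k z Hz). lra.
      * exists (RtoC 1). intros eps He. exists 1. split; [lra|]. intros w _.
        replace (z + w - z - 1 * w)%C with (RtoC 0) by ring. rewrite Cmod_0.
        pose proof (Cmod_ge_0 w). nra.
      * intros k. now apply H1.
    + intros z Hz. apply f_bound; [lra|]. intros k. specialize (H3 k z Hz). lra.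
    + transitivity (f j (RtoC 0) (fun _ => RtoC 0)); [|apply f_0].
      f_equal. apply functional_extensionality. exact H2.
  - now exists v.
Qed.

Lemma solves_contraction (delta A : R) (m : nat) (u u' v v' : I -> C -> C) :
  0 < delta <= rho -> (1 <= m)%nat -> 2 * (16 * M / rho) <= INR m -> 0 <= A ->
  admissible delta u -> admissible delta u' -> solves delta u v -> solves delta u' v' ->
  (forall k z, Cmod z < delta -> Cmod (u k z - u' k z)%C <= A * Cmod z ^ m) ->
  forall j z, Cmod z < delta -> Cmod (v j z - v' j z)%C <= A / 2 * Cmod z ^ m.
Proof.
  intros Hd Hm HL HA (_ & _ & Hu) (_ & _ & Hu') Sv Sv' Huu j z Hz.
  assert (Hm0 : 0 < INR m) by (apply lt_0_INR; lia).
  set (L := 16 * M / rho) in *. pose proof (Cmod_ge_0 z) as Hz0.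
  assert (Hzm : 0 <= A * Cmod z ^ m) by (apply Rmult_le_pos; trivial; now apply pow_le).
  destruct (Sv j) as [Sv0 Sv1]. destruct (Sv' j) as [Sv0' Sv1'].
  pose proof (euler_estimate_exists (fun s => v j (RtoC s * z) - v' j (RtoC s * z))%C
    (L * A * Cmod z ^ m) m Hm) as HE. cbv beta in HE.
  replace (RtoC 1 * z)%C with z in HE by ring.
  replace (RtoC 0 * z)%C with (RtoC 0) in HE by ring.
  eapply Rle_trans; [apply HE|].
  - rewrite Sv0, Sv0'. ring.
  - intros s Hs.
    assert (Hsz : Cmod (RtoC s * z)%C = s * Cmod z) by (apply Cmod_RtoC_mult; lra).
    assert (Hsd : Cmod (RtoC s * z)%C < delta) by (rewrite Hsz; nra).
    destruct (Sv1 _ Hsd) as [c [Hc1 Hc2]]. destruct (Sv1' _ Hsd) as [c' [Hc1' Hc2']].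
    exists (z * c - z * c')%C. split.
    + apply has_deriv_R_minus; now apply has_deriv_along_ray.
    + replace (RtoC s * (z * c - z * c'))%C
        with (RtoC s * z * c - RtoC s * z * c')%C by ring.
      rewrite Hc2, Hc2'.
      replace (L * A * Cmod z ^ m * s ^ m) with (L * (A * (s * Cmod z) ^ m))
        by (rewrite Rpow_mult_distr; ring).
      apply f_lipschitz; [lra|auto|auto| |].
      * apply Rmult_le_pos; trivial. apply pow_le. nra.
      * intros k. rewrite <- Hsz. now apply Huu.
  - apply (Rmult_le_reg_r (INR m)); trivial.
    replace (L * A * Cmod z ^ m / INR m * INR m) with (L * (A * Cmod z ^ m)) by (field; lra).
    replace (A / 2 * Cmod z ^ m * INR m) with (INR m / 2 * (A * Cmod z ^ m)) by field.
    apply Rmult_le_compat_r; lra.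
Qed.

Section SmoothSolution.
Variables (y : I -> R -> C) (r : R).
Hypothesis Hr : 0 < r.
Hypothesis y_smooth : forall j, smooth_on r (y j).
Hypothesis y_0 : forall j, y j 0 = RtoC 0.
Hypothesis y_ode : forall j t, Rabs t < r ->
  (RtoC t * cderive (y j) t)%C = f j (RtoC t) (fun k => y k t).

(** On the real line [y] is a fixed point of the iteration, so the estimate of [solves_contraction]
    applies with [y] as both input and output. *)
Lemma smooth_solution_contraction (delta A : R) (m : nat) (u v : I -> C -> C) :
  0 < delta <= rho -> delta <= r -> (1 <= m)%nat -> 2 * (16 * M / rho) <= INR m -> 0 <= A ->
  (forall j t, Rabs t < delta -> Cmod (y j t) < rho / 2) ->
  admissible delta u -> solves delta u v ->
  (forall k t, Rabs t < delta -> Cmod (y k t - u k (RtoC t))%C <= A * Rabs t ^ m) ->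
  forall j t, Rabs t < delta -> Cmod (y j t - v j (RtoC t))%C <= A / 2 * Rabs t ^ m.
Proof.
  intros Hd Hdr Hm HL HA Hy (_ & _ & Hu) Sv Huy j t Ht.
  assert (Hm0 : 0 < INR m) by (apply lt_0_INR; lia).
  set (L := 16 * M / rho) in *. pose proof (Rabs_pos t) as Ht0.
  assert (Hzm : 0 <= A * Rabs t ^ m) by (apply Rmult_le_pos; trivial; now apply pow_le).
  destruct (Sv j) as [Sv0 Sv1].
  pose proof (euler_estimate_exists (fun s => y j (s * t)%R - v j (RtoC s * RtoC t))%C
    (L * A * Rabs t ^ m) m Hm) as HE. cbv beta in HE.
  rewrite Rmult_1_l, Rmult_0_l in HE.
  replace (RtoC 1 * RtoC t)%C with (RtoC t) in HE by ring.
  replace (RtoC 0 * RtoC t)%C with (RtoC 0) in HE by ring.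
  eapply Rle_trans; [apply HE|].
  - rewrite y_0, Sv0. ring.
  - intros s Hs.
    assert (Hst : Rabs (s * t) = s * Rabs t) by (rewrite Rabs_mult, (Rabs_pos_eq s); lra).
    assert (Hsd : Rabs (s * t) < delta) by (rewrite Hst; nra).
    destruct (Sv1 (RtoC s * RtoC t)%C) as [c [Hc1 Hc2]].
    { now rewrite <- RtoC_mult, Cmod_R. }
    exists (RtoC t * cderive (y j) (s * t)%R - RtoC t * c)%C. split.
    + apply has_deriv_R_minus; [|now apply has_deriv_along_ray].
      apply (has_deriv_R_dilation (y j) r); trivial. lra.
    + replace (RtoC s * (RtoC t * cderive (y j) (s * t)%R - RtoC t * c))%C
        with (RtoC (s * t) * cderive (y j) (s * t)%R - RtoC s * RtoC t * c)%C
        by (rewrite RtoC_mult; ring).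
      rewrite Hc2, <- RtoC_mult, y_ode by lra.
      replace (L * A * Rabs t ^ m * s ^ m) with (L * (A * (s * Rabs t) ^ m))
        by (rewrite Rpow_mult_distr; ring).
      assert (Hc : Cmod (RtoC (s * t)) < delta) by now rewrite Cmod_R.
      apply f_lipschitz; [lra|auto|auto| |].
      * apply Rmult_le_pos; trivial. apply pow_le. nra.
      * intros k. rewrite <- Hst. now apply Huy.
  - apply (Rmult_le_reg_r (INR m)); trivial.
    replace (L * A * Rabs t ^ m / INR m * INR m) with (L * (A * Rabs t ^ m)) by (field; lra).
    replace (A / 2 * Rabs t ^ m * INR m) with (INR m / 2 * (A * Rabs t ^ m)) by field.
    apply Rmult_le_compat_r; lra.
Qed.

Lemma uniform_polynomial_approximation (m : nat) :
  exists (P : I -> C -> C) (K : R), 0 < K /\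
    (forall j z, exists c, has_deriv (P j) z c) /\
    forall j t, Rabs t <= r / 2 -> Cmod (y j t - P j (RtoC t))%C <= K * Rabs t ^ m.
Proof.
  destruct (pointwise_choice I (nat -> C) (fun j c => exists K, 0 <= K /\ forall t,
    Rabs t <= r / 2 -> Cmod (y j t - Csum (pterm c (RtoC t)) m)%C <= K * Rabs t ^ m))
    as [c Hc].
  { intros j. apply smooth_on_polynomial_approximation; auto. }
  (* The uniformity principle yields small thresholds, so the common constant is encoded as [/ d]:
     shrinking [d] only weakens the bound. *)
  destruct (Huni (fun j d => forall t, Rabs t <= r / 2 ->
    Cmod (y j t - Csum (pterm (c j) (RtoC t)) m)%C <= / d * Rabs t ^ m)) as [d [Hd Hd']].
  { intros j. destruct (Hc j) as [K [HK0 HK]]. exists (/ (K + 1)). split.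
    { apply Rinv_0_lt_compat. lra. }
    intros d' Hd' t Ht. eapply Rle_trans; [now apply HK|].
    apply Rmult_le_compat_r; [apply pow_le, Rabs_pos|].
    apply Rle_trans with (K + 1); [lra|]. rewrite <- (Rinv_inv (K + 1)).
    apply Rinv_le_contravar; lra. }
  exists (fun j z => Csum (pterm (c j) z) m), (/ d). repeat split; trivial.
  - now apply Rinv_0_lt_compat.
  - intros j z. apply has_deriv_polynomial.
Qed.

Lemma smooth_solution_analytic (j0 : I) : real_analytic_near_0 (y j0).
Proof.
  set (L := 16 * M / rho).
  (* The extra 1 ensures [m >= 1] even when [L = 0]. *)
  destruct (INR_archimed 1 (2 * L + 1) Rlt_0_1) as [m Hm]. rewrite Rmult_1_r in Hm.
  assert (HL0 : 0 <= L) by (apply Rdiv_le_0_compat; lra).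
  assert (Hm1 : (1 <= m)%nat) by (destruct m; [simpl in Hm; lra|lia]).
  assert (HLm : 2 * (16 * M / rho) <= INR m) by (fold L; lra).
  destruct (uniform_polynomial_approximation m) as [P [K [HK [HP HyP]]]].
  assert (HP0 : forall j, P j (RtoC 0) = RtoC 0).
  { intros j. apply eq_of_Cmod_minus_le. intros eps He.
    specialize (HyP j 0). rewrite Rabs_R0, pow_i, y_0, Cmod_minus_sym in HyP by lia.
    specialize (HyP ltac:(lra)). lra. }
  (* The two bounds by [rho / 4] are for [P] and for [|y - P| <= K |t|^m <= K d0]; together they
     keep [y] below [rho / 2]. *)
  assert (Hd0 : exists d0, 0 < d0 /\ d0 <= r / 2 /\ d0 <= rho /\ d0 <= 1 /\ K * d0 <= rho / 4 /\
    forall j z, Cmod z < d0 -> Cmod (P j z) < rho / 4).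
  { destruct (Huni (fun j d => forall z, Cmod z < d -> Cmod (P j z) < rho / 4))
      as [d1 [Hd1 Hd1']].
    { intros j. destruct (HP j (RtoC 0)) as [c Hc].
      destruct (has_deriv_continuous _ _ _ Hc (rho / 4)) as [d [Hd Hd']]; [lra|].
      exists d. split; trivial. intros d' Hdd z Hz.
      specialize (Hd' z). rewrite HP0 in Hd'.
      replace (z - 0)%C with z in Hd' by ring.
      replace (P j z - 0)%C with (P j z) in Hd' by ring. apply Hd'. lra. }
    set (d0 := Rmin (Rmin d1 (r / 2)) (Rmin (Rmin rho 1) (rho / 4 / K))).
    assert (D : 0 < d0 /\ d0 <= d1 /\ d0 <= r / 2 /\ d0 <= rho /\ d0 <= 1 /\ d0 <= rho / 4 / K).
    { assert (0 < rho / 4 / K) by (apply Rdiv_lt_0_compat; lra).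
      pose proof (Rmin_l (Rmin d1 (r / 2)) (Rmin (Rmin rho 1) (rho / 4 / K))).
      pose proof (Rmin_r (Rmin d1 (r / 2)) (Rmin (Rmin rho 1) (rho / 4 / K))).
      pose proof (Rmin_l d1 (r / 2)). pose proof (Rmin_r d1 (r / 2)).
      pose proof (Rmin_l (Rmin rho 1) (rho / 4 / K)).
      pose proof (Rmin_r (Rmin rho 1) (rho / 4 / K)).
      pose proof (Rmin_l rho 1). pose proof (Rmin_r rho 1).
      fold d0 in H0, H1. split; [|lra].
      unfold d0. repeat apply Rmin_pos; lra. }
    destruct D as (D0 & D1 & D2 & D3 & D4 & D5). exists d0. repeat split; trivial.
    - apply (Rmult_le_compat_l K) in D5; [|lra].
      replace (K * (rho / 4 / K)) with (rho / 4) in D5 by (field; lra). exact D5.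
    - intros j z Hz. apply Hd1'. lra. }
  destruct Hd0 as (d0 & D0 & Dr & Drho & D1 & DK & HPb).
  assert (Hyb : forall j t, Rabs t < d0 -> Cmod (y j t) < rho / 2).
  { intros j t Ht. replace (y j t) with ((y j t - P j (RtoC t)) + P j (RtoC t))%C by ring.
    eapply Rle_lt_trans; [apply Cmod_triangle|].
    specialize (HyP j t ltac:(lra)). specialize (HPb j (RtoC t)). rewrite Cmod_R in HPb.
    specialize (HPb Ht). pose proof (Rabs_pos t) as Ht0.
    pose proof (pow_le_self (Rabs t) m Hm1 ltac:(lra)). nra. }
  assert (adP : forall d, d <= d0 -> admissible d P).
  { intros d Hd. repeat split; trivial. intros j z Hz. specialize (HPb j z ltac:(lra)). lra. }
  destruct (solves_exists d0 P) as [y1 Sy1]; [lra|apply adP; lra|].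
  (* Both functions approximate [y] on the real line, [P] up to [K] and [y1] up to [K / 2]. *)
  assert (Hy1 : forall j t, Rabs t < d0 ->
    Cmod (y1 j (RtoC t) - P j (RtoC t))%C <= 2 * K * Rabs t ^ m).
  { intros j t Ht.
    assert (H1 : Cmod (y j t - y1 j (RtoC t))%C <= K / 2 * Rabs t ^ m).
    { apply (smooth_solution_contraction d0 K m P y1); trivial; try lra.
      - apply adP. lra.
      - intros k s Hs. apply HyP. lra. }
    specialize (HyP j t ltac:(lra)).
    replace (y1 j t - P j t)%C with ((y j t - P j t) - (y j t - y1 j t))%C by ring.
    eapply Rle_trans; [apply Cmod_triangle_minus|].
    assert (0 <= K * Rabs t ^ m).
    { apply Rmult_le_pos; [lra|]. apply pow_le, Rabs_pos. }
    lra. }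
  (* The passage from the real line to the complex disc. One number plays two roles, as the radius
     of the disc and, inverted, as the constant. *)
  destruct (Huni (fun j d => forall z, Cmod z < d ->
    Cmod (y1 j z - P j z)%C <= / d * Cmod z ^ m)) as [d1 [Hd1 Hd1']].
  { intros j. destruct (Sy1 j) as [Sy0 Sy]. specialize (HP j).
    assert (HE : forall z, Cmod z < d0 -> exists c, has_deriv (fun z => y1 j z - P j z)%C z c).
    { intros z Hz. destruct (Sy z Hz) as [c [Hc _]]. destruct (HP z) as [c' Hc'].
      exists (c - c')%C. now apply has_deriv_minus. }
    destruct (HE (RtoC 0)) as [c Hc]; [rewrite Cmod_0; lra|].
    (* Continuity at zero supplies the normalization [|y1 - P| <= 1] near the origin. *)
    destruct (has_deriv_continuous _ _ _ Hc 1 Rlt_0_1) as [e [He He']].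
    set (eta := Rmin e d0).
    assert (Heta : 0 < eta) by now apply Rmin_pos.
    assert (eta <= e /\ eta <= d0) as [Ee Ed] by (split; [apply Rmin_l|apply Rmin_r]).
    pose proof (power_series_vanishing_order (fun z => y1 j z - P j z)%C eta (2 * K) m Heta)
      as HV.
    set (B := 4 / (eta / 2) ^ m) in HV.
    assert (HB : 0 < B) by (apply Rdiv_lt_0_compat; [lra|apply pow_lt; lra]).
    assert (HV' : forall z, Cmod z < eta / 4 -> Cmod (y1 j z - P j z)%C <= B * Cmod z ^ m).
    { apply HV.
      - intros z Hz. apply HE. lra.
      - intros z Hz. specialize (He' z). rewrite Sy0, HP0 in He'.
        replace (z - 0)%C with z in He' by ring.
        replace (y1 j z - P j z - (0 - 0))%C with (y1 j z - P j z)%C in He' by ring.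
        apply Rlt_le, He'. lra.
      - intros t Ht. specialize (Hy1 j t). rewrite Rabs_pos_eq in Hy1 by lra.
        apply Hy1. lra. }
    exists (Rmin (eta / 4) (/ B)). split.
    { apply Rmin_pos; [lra|]. now apply Rinv_0_lt_compat. }
    intros d Hd z Hz.
    pose proof (Rmin_l (eta / 4) (/ B)). pose proof (Rmin_r (eta / 4) (/ B)).
    eapply Rle_trans; [apply HV'; lra|].
    apply Rmult_le_compat_r; [apply pow_le, Cmod_ge_0|].
    rewrite <- (Rinv_inv B). apply Rinv_le_contravar; lra. }
  set (B := / d1) in Hd1'. assert (HB : 0 < B) by now apply Rinv_0_lt_compat.
  (* On this disc [2 * B * |z|^m <= rho / 4], so every function in the ball [close] around [P] stays
     below [rho / 2]. *)
  set (d := Rmin d1 (Rmin d0 (rho / 4 / (2 * B)))).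
  assert (D : 0 < d /\ d <= d1 /\ d <= d0 /\ d <= rho / 4 / (2 * B)).
  { assert (0 < rho / 4 / (2 * B)) by (apply Rdiv_lt_0_compat; lra).
    pose proof (Rmin_l d1 (Rmin d0 (rho / 4 / (2 * B)))).
    pose proof (Rmin_r d1 (Rmin d0 (rho / 4 / (2 * B)))).
    pose proof (Rmin_l d0 (rho / 4 / (2 * B))). pose proof (Rmin_r d0 (rho / 4 / (2 * B))).
    fold d in H0, H1. split; [|lra]. unfold d. repeat apply Rmin_pos; lra. }
  destruct D as (Hd & Ddd1 & Ddd0 & DB).
  apply (Rmult_le_compat_l (2 * B)) in DB; [|lra].
  replace (2 * B * (rho / 4 / (2 * B))) with (rho / 4) in DB by (field; lra).
  pose (close := fun u : I -> C -> C => forall j z, Cmod z < d ->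
    Cmod (u j z - P j z)%C <= 2 * B * Cmod z ^ m).
  assert (Hpm : forall z, Cmod z < d -> 0 <= Cmod z ^ m <= Cmod z).
  { intros z Hz. pose proof (Cmod_ge_0 z). split; [now apply pow_le|].
    apply pow_le_self; trivial. lra. }
  assert (ad_close : forall u : I -> C -> C,
    (forall j z, Cmod z < d -> exists c, has_deriv (u j) z c) ->
    (forall j, u j (RtoC 0) = RtoC 0) -> close u -> admissible d u).
  { intros u H1 H2 H3. repeat split; trivial. intros j z Hz.
    replace (u j z) with ((u j z - P j z) + P j z)%C by ring.
    eapply Rle_lt_trans; [apply Cmod_triangle|].
    specialize (H3 j z Hz). specialize (HPb j z ltac:(lra)). specialize (Hpm z Hz). nra. }
  assert (Sy1d : solves d P y1).
  { intros j. destruct (Sy1 j) as [S0 S1]. split; trivial. intros z Hz. apply S1. lra. }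
  destruct (dependent_choice (I -> C -> C) (fun u => admissible d u /\ close u) (solves d) P)
    as [U [U0 HU]].
  { split; [now apply adP|]. intros j z Hz.
    replace (P j z - P j z)%C with (RtoC 0) by ring. rewrite Cmod_0.
    specialize (Hpm z Hz). apply Rmult_le_pos; lra. }
  { intros u [Hu1 Hu2]. destruct (solves_exists d u) as [v Sv]; [lra|trivial|].
    exists v. split; [|exact Sv].
    (* The ball is mapped into itself: [u] is within [2 B] of [P], so [v] is within [B] of [y1], and
       [y1] is within [B] of [P]. *)
    assert (Hc : close v).
    { intros j z Hz.
      assert (H1 : Cmod (v j z - y1 j z)%C <= 2 * B / 2 * Cmod z ^ m).
      { apply (solves_contraction d (2 * B) m u P v y1); trivial; try lra.
        now apply adP. }
      specialize (Hd1' j z ltac:(lra)).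
      replace (v j z - P j z)%C with ((v j z - y1 j z) + (y1 j z - P j z))%C by ring.
      eapply Rle_trans; [apply Cmod_triangle|]. lra. }
    split; trivial. apply ad_close; trivial.
    - intros j z Hz. destruct (Sv j) as [_ Sv1]. destruct (Sv1 z Hz) as [c [Hc' _]].
      now exists c.
    - intros j. apply (Sv j). }
  assert (HUS : forall k j z, Cmod z < d ->
    Cmod (U (S k) j z - U k j z)%C <= 2 * B * (/ 2) ^ k * Cmod z ^ m).
  { intros k. induction k as [|k IH]; intros j z Hz.
    - rewrite U0. destruct (HU 1%nat) as [[_ Hc] _]. simpl. rewrite Rmult_1_r. now apply Hc.
    - replace (2 * B * (/ 2) ^ S k) with (2 * B * (/ 2) ^ k / 2) by (simpl; field).
      assert (0 <= (/ 2) ^ k) by (apply pow_le; lra).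
      apply (solves_contraction d _ m (U (S k)) (U k)); trivial; try lra.
      + apply Rmult_le_pos; lra.
      + apply HU.
      + apply HU.
      + apply HU.
      + apply HU. }
  assert (HUy : forall k j t, Rabs t < d ->
    Cmod (y j t - U k j (RtoC t))%C <= K * (/ 2) ^ k * Rabs t ^ m).
  { intros k. induction k as [|k IH]; intros j t Ht.
    - rewrite U0. simpl. rewrite Rmult_1_r. apply HyP. lra.
    - replace (K * (/ 2) ^ S k) with (K * (/ 2) ^ k / 2) by (simpl; field).
      assert (0 <= (/ 2) ^ k) by (apply pow_le; lra).
      apply (smooth_solution_contraction d _ m (U k)); trivial; try lra.
      + apply Rmult_le_pos; lra.
      + intros i s Hs. apply Hyb. lra.
      + apply HU.
      + apply HU. }
  (* The constant majorizes all three bounds: [rho / 2] for the starting polynomial, [2 B] for the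
     increments and [K] for the distance to [y]; [|z|^m <= 1] because [d <= 1]. *)
  apply (real_analytic_of_geometric_limit (y j0) (fun k => U k j0) d (rho + 2 * B + K)); trivial.
  - intros k z Hz. destruct (HU k) as [[[H1 _] _] _]. now apply H1.
  - intros z Hz. destruct (HU O) as [[[_ [_ H1]] _] _]. specialize (H1 j0 z Hz). lra.
  - intros k z Hz. eapply Rle_trans; [now apply HUS|]. specialize (Hpm z Hz).
    assert (0 <= (/ 2) ^ k) by (apply pow_le; lra).
    apply Rle_trans with (2 * B * (/ 2) ^ k * 1).
    + apply Rmult_le_compat_l; [|lra]. apply Rmult_le_pos; lra.
    + rewrite Rmult_1_r. apply Rmult_le_compat_r; lra.
  - intros k t Ht. eapply Rle_trans; [now apply HUy|].
    assert (Hmt : Cmod (RtoC t) < d) by now rewrite Cmod_R.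
    specialize (Hpm (RtoC t) Hmt). rewrite Cmod_R in Hpm, Hmt.
    assert (0 <= (/ 2) ^ k) by (apply pow_le; lra).
    apply Rle_trans with (K * (/ 2) ^ k * 1).
    + apply Rmult_le_compat_l; [|lra]. apply Rmult_le_pos; lra.
    + rewrite Rmult_1_r. apply Rmult_le_compat_r; lra.
Qed.
End SmoothSolution.
End BriotBouquet.

(** * Holomorphic functions of several variables *)

From mathcomp Require Import ssreflect ssrfun ssrbool eqtype ssrnat seq fintype bigop.
Open Scope R_scope.

Lemma ordinal_uniform_thresholds (N : nat) : uniform_thresholds 'I_N.
Proof.
  move=> Q HQ.
  have [d [Hd Hs]] : exists d, 0 < d /\
      forall j, j \in enum 'I_N -> forall d', 0 < d' <= d -> Q j d'.
  { elim: (enum 'I_N) => [|i s [d [Hd IH]]].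
    - exists 1; split; [lra | by []].
    - have [e [He Hi]] := HQ i.
      have ? := Rmin_l d e. have ? := Rmin_r d e.
      exists (Rmin d e); split; first by apply: Rmin_pos.
      move=> j; rewrite inE => /orP [/eqP -> | Hj] d' Hd'.
      + apply: Hi; lra.
      + apply: IH => //; lra. }
  exists d; split=> // j. apply: Hs; [exact: mem_enum | lra].
Qed.

Lemma Cmod_csum_le (N : nat) (v : 'I_N -> C) : Cmod (csum v) <= rsum (fun k => Cmod (v k)).
Proof.
  rewrite /csum /rsum. elim/big_rec2: _ => [|i x z _ IH].
  - rewrite Cmod_0; lra.
  - apply: Rle_trans; first exact: Cmod_triangle. lra.
Qed.

Lemma rsum_le (N : nat) (u v : 'I_N -> R) : (forall k, u k <= v k) -> rsum u <= rsum v.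
Proof.
  move=> H. rewrite /rsum. elim/big_rec2: _ => [|i x z _ IH]; first by lra.
  have := H i. lra.
Qed.

Lemma rsum_scal (N : nat) (c : R) (u : 'I_N -> R) : rsum (fun k => u k * c) = rsum u * c.
Proof.
  rewrite /rsum. elim/big_rec2: _ => [|i x z _ ->]; ring.
Qed.

Lemma csum_linear (N : nat) (a u d : 'I_N -> C) (v : C) :
  csum (fun k => a k * (u k - d k * v))%C =
  (csum (fun k => a k * u k) - csum (fun k => a k * d k) * v)%C.
Proof.
  rewrite /csum. elim/big_rec3: _ => [|i x z t _ ->]; ring.
Qed.

Lemma C_differentiable_comp (N : nat) (F : C -> ('I_N -> C) -> C)
    (z0 : C -> C) (w : 'I_N -> C -> C) (x : C) :
  C_differentiable_at F (z0 x) (fun k => w k x) ->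
  (exists c, has_deriv z0 x c) -> (forall k, exists c, has_deriv (w k) x c) ->
  exists c, has_deriv (fun x => F (z0 x) (fun k => w k x)) x c.
Proof.
  move=> [a0 [a HF]] [d0 Hz0] /pointwise_choice [d Hw].
  exists (a0 * d0 + csum (fun k => a k * d k))%C => eps He.
  (* [S] measures the differential of [F]; [D] bounds the total growth of the inner functions per
     unit of [|v|]. *)
  pose S := Cmod a0 + rsum (fun k => Cmod (a k)).
  pose D := Cmod d0 + 1 + rsum (fun k => Cmod (d k) + 1).
  have rsum_ge0 : forall u : 'I_N -> R, (forall k, 0 <= u k) -> 0 <= rsum u.
  { move=> u Hu. have := rsum_le N (fun k => u k * 0) u.
    rewrite rsum_scal Rmult_0_r. apply=> k. have := Hu k. lra. }
  have HS : 0 <= S.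
  { have ? := Cmod_ge_0 a0.
    have := rsum_ge0 _ (fun k => Cmod_ge_0 (a k)). rewrite /S. lra. }
  have HD : 0 < D.
  { have ? := Cmod_ge_0 d0. have : 0 <= rsum (fun k => Cmod (d k) + 1); last by rewrite /D; lra.
    apply: rsum_ge0 => k. have := Cmod_ge_0 (d k). lra. }
  (* The entry 1 bounds an inner increment by [(|c| + 1) |v|]; the other entry keeps the inner
     remainders, weighted by [S], below [eps / 2 * |v|]. *)
  pose e2 := Rmin 1 (eps / (2 * (S + 1))).
  have He2 : 0 < e2.
  { apply: Rmin_pos; first by lra. apply: Rdiv_lt_0_compat; lra. }
  have He21 : e2 <= 1 by apply: Rmin_l.
  have He2S : e2 * S <= eps / 2.
  { have H : e2 <= eps / (2 * (S + 1)) by apply: Rmin_r.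
    have H2 : eps / (2 * (S + 1)) * (S + 1) = eps / 2 by field; lra.
    nra. }
  have [d1 [Hd1 HF1]] := HF (eps / (2 * D)) ltac:(apply Rdiv_lt_0_compat; lra).
  have incr : forall (h : C -> C) c, has_deriv h x c -> exists e, 0 < e /\
      forall v, Cmod v < e -> Cmod (h (x + v) - h x - c * v)%C <= e2 * Cmod v /\
                              Cmod (h (x + v) - h x)%C < d1.
  { move=> h c Hh. have [e [He' K]] := Hh e2 He2.
    have [e' [He'' K']] := has_deriv_continuous _ _ _ Hh d1 Hd1.
    exists (Rmin e e'); split; first by apply: Rmin_pos.
    move=> v Hv. have ? := Rmin_l e e'. have ? := Rmin_r e e'. split.
    - apply: K; lra.
    - apply: K'. have -> : (x + v - x)%C = v by ring. lra. }
  have [e0 [He0 K0]] := incr _ _ Hz0.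
  have [e1 [He1 K1]] := ordinal_uniform_thresholds N
    (fun k e => forall v, Cmod v < e ->
       Cmod (w k (x + v)%C - w k x - d k * v)%C <= e2 * Cmod v /\
       Cmod (w k (x + v)%C - w k x)%C < d1)
    (fun k => let: ex_intro e (conj He Hk) := incr _ _ (Hw k) in
       ex_intro _ e (conj He (fun e' He' v Hv => Hk v (Rlt_le_trans _ _ _ Hv (proj2 He'))))).
  exists (Rmin e0 e1); split; first by apply: Rmin_pos.
  move=> v Hv. have ? := Rmin_l e0 e1. have ? := Rmin_r e0 e1.
  have [A0 B0] := K0 v ltac:(lra).
  have AB k := K1 k v ltac:(lra).
  have Hv0 := Cmod_ge_0 v.
  pose u0 := (z0 (x + v) - z0 x)%C. pose u k := (w k (x + v) - w k x)%C.
  have growth : forall p c : C, Cmod (p - c * v)%C <= e2 * Cmod v ->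
      Cmod p <= (Cmod c + 1) * Cmod v.
  { move=> p c Hp. have -> : p = ((p - c * v) + c * v)%C by ring.
    apply: Rle_trans; first exact: Cmod_triangle. rewrite Cmod_mult. nra. }
  have := HF1 u0 u B0 (fun k => proj2 (AB k)).
  have -> : (z0 x + u0)%C = z0 (x + v)%C by rewrite /u0; ring.
  have -> : (fun k => w k x + u k)%C = (fun k => w k (x + v)%C).
  { apply: functional_extensionality => k. rewrite /u. ring. }
  move=> HF2.
  have HF3 : eps / (2 * D) * (Cmod u0 + rsum (fun k => Cmod (u k))) <= eps / 2 * Cmod v.
  { have -> : eps / 2 * Cmod v = eps / (2 * D) * (D * Cmod v) by field; lra.
    apply: Rmult_le_compat_l; first by apply: Rlt_le; apply: Rdiv_lt_0_compat; lra.
    have H1 := growth _ _ A0.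
    have H2 := rsum_le N (fun k => Cmod (u k)) _ (fun k => growth _ _ (proj1 (AB k))).
    rewrite rsum_scal in H2. rewrite /D /u0. lra. }
  have HL : Cmod (a0 * (u0 - d0 * v) + csum (fun k => a k * (u k - d k * v)))%C
      <= eps / 2 * Cmod v.
  { apply: Rle_trans; first exact: Cmod_triangle. rewrite Cmod_mult.
    have H1 : Cmod a0 * Cmod (u0 - d0 * v)%C <= Cmod a0 * (e2 * Cmod v).
    { apply: Rmult_le_compat_l => //. exact: Cmod_ge_0. }
    have H2 := Cmod_csum_le N (fun k => a k * (u k - d k * v))%C.
    have H3 : rsum (fun k => Cmod (a k * (u k - d k * v))%C) <=
              rsum (fun k => Cmod (a k) * (e2 * Cmod v)).
    { apply: rsum_le => k. rewrite Cmod_mult. apply: Rmult_le_compat_l; first exact: Cmod_ge_0.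
      exact: (proj1 (AB k)). }
    rewrite rsum_scal in H3.
    have : S * (e2 * Cmod v) <= eps / 2 * Cmod v by nra.
    rewrite /S. lra. }
  (* The remainder of [F] at the actual increments, plus the differential of [F] applied to the
     inner remainders; each takes half of [eps]. *)
  have -> : (F (z0 (x + v)) (fun k => w k (x + v)) - F (z0 x) (fun k => w k x)
     - (a0 * d0 + csum (fun k => a k * d k)) * v)%C =
    ((F (z0 (x + v)) (fun k => w k (x + v)) - F (z0 x) (fun k => w k x)
       - (a0 * u0 + csum (fun k => a k * u k)))
     + (a0 * (u0 - d0 * v) + csum (fun k => a k * (u k - d k * v))))%C.
  { rewrite csum_linear. ring. }
  apply: Rle_trans; first exact: Cmod_triangle. lra.
Qed.

(** The differential inequality at the single point zero, with [eps = 1], already bounds [F] nearby,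
    so the constant for Cauchy's estimates needs no compactness argument. *)
Lemma C_differentiable_locally_bounded (N : nat) (F : C -> ('I_N -> C) -> C) :
  C_differentiable_at F (RtoC 0) (fun _ => RtoC 0) ->
  exists (d B : R), 0 < d /\ 0 < B /\ forall z w,
    Cmod z < d -> (forall k, Cmod (w k) < d) -> Cmod (F z w) <= B.
Proof.
  move=> [a0 [a HF]]. have [d [Hd K]] := HF 1 Rlt_0_1.
  pose B := Cmod (F (RtoC 0) (fun _ => RtoC 0)) + (Cmod a0 + rsum (fun k => Cmod (a k)))
    + (1 + rsum (fun _ : 'I_N => 1)).
  exists (Rmin d 1), (Rabs B + 1). have ? := Rabs_pos B.
  have ? := Rmin_l d 1. have ? := Rmin_r d 1.
  split; [apply: Rmin_pos; lra | split; [lra|]] => z w Hz Hw.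
  have {K} := K z w ltac:(lra) (fun k => Rlt_le_trans _ _ _ (Hw k) (Rmin_l _ _)).
  have -> : (0 + z)%C = z by ring.
  have -> : (fun k => 0 + w k)%C = w by apply: functional_extensionality => k; ring.
  set F0 := F (RtoC 0) _. set L := (a0 * z + _)%C => HK.
  have HL : Cmod L <= Cmod a0 + rsum (fun k => Cmod (a k)).
  { apply: Rle_trans; first exact: Cmod_triangle. rewrite Cmod_mult.
    have ? := Cmod_ge_0 a0. have ? := Cmod_csum_le N (fun k => a k * w k)%C.
    have ? : rsum (fun k => Cmod (a k * w k)%C) <= rsum (fun k => Cmod (a k)).
    { apply: rsum_le => k. rewrite Cmod_mult. have := Cmod_ge_0 (a k). have := Hw k. nra. }
    nra. }
  have ? : rsum (fun k => Cmod (w k)) <= rsum (fun _ : 'I_N => 1).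
  { apply: rsum_le => k. have := Hw k. lra. }
  have -> : F z w = (F z w - F0 - L + L + F0)%C by ring.
  have ? := Cmod_triangle (F z w - F0 - L + L) F0.
  have ? := Cmod_triangle (F z w - F0 - L) L.
  have := Rle_abs B. rewrite {1}/B -/F0. lra.
Qed.

Theorem theorem5p1 (N : nat) (y : 'I_N -> R -> C)
  (f : 'I_N -> C -> ('I_N -> C) -> C)
  (hf : forall j, holomorphic_near_0 (f j))
  (r : R) (hr : 0 < r)
  (hsmooth : forall j, smooth_on r (y j))
  (hy0 : forall j, y j 0 = RtoC 0)
  (hode : forall (j : 'I_N) (t : R), Rabs t < r ->
     Cmult (RtoC t) (cderive (y j) t) = f j (RtoC t) (fun k => y k t)) :
  forall j, real_analytic_near_0 (y j).
Proof.
  (* Taking [/ rho] as the bound puts domain and bound under one threshold: shrinking [rho] weakens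
     both requirements, so finitely many components can share it. *)
  pose Q (j : 'I_N) rho :=
    (forall z w, Cmod z < rho -> (forall k, Cmod (w k) < rho) ->
       C_differentiable_at (f j) z w) /\
    (forall z w, Cmod z < rho -> (forall k, Cmod (w k) < rho) -> Cmod (f j z w) <= / rho).
  have [rho [Hrho Hf]] : exists rho, 0 < rho /\ forall j, Q j rho.
  { apply: ordinal_uniform_thresholds => j. have [rho [Hrho Hd]] := hf j.
    have [d [B [Hd0 [HB Hb]]]] : exists d B, 0 < d /\ 0 < B /\ forall z w,
        Cmod z < d -> (forall k, Cmod (w k) < d) -> Cmod (f j z w) <= B.
    { apply: C_differentiable_locally_bounded. apply: Hd => [|k]; rewrite Cmod_0; lra. }
    have ? := Rinv_0_lt_compat B HB.
    exists (Rmin rho (Rmin d (/ B))); split; first by do 2 (apply: Rmin_pos => //).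
    have ? := Rmin_l rho (Rmin d (/ B)). have ? := Rmin_r rho (Rmin d (/ B)).
    have ? := Rmin_l d (/ B). have ? := Rmin_r d (/ B).
    move=> d' Hd'; split=> z w Hz Hw.
    - apply: Hd => [|k]; first by lra. have := Hw k. lra.
    - apply: (Rle_trans _ B).
      + apply: Hb => [|k]; first by lra. have := Hw k. lra.
      + rewrite -{1}(Rinv_inv B). apply: Rinv_le_contravar; lra. }
  (* The equation at [t = 0], where its left side vanishes. *)
  have f0 j : f j (RtoC 0) (fun _ => RtoC 0) = RtoC 0.
  { have -> : (fun _ : 'I_N => RtoC 0) = (fun k => y k 0)
      by apply: functional_extensionality => k; rewrite hy0.
    rewrite -hode; first by ring. rewrite Rabs_R0; lra. }
  move=> j.
  apply: (smooth_solution_analytic 'I_N f rho (/ rho) (ordinal_uniform_thresholds N)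
            Hrho _ _ _ f0 y r) => //.
  - exact: Rlt_le (Rinv_0_lt_compat _ Hrho).
  - move=> i z0 w x Hz Hw dz dw.
    apply: C_differentiable_comp => //. exact: (proj1 (Hf i)).
  - move=> i. exact: (proj2 (Hf i)).
Qed.
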